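(* Let $p\ge1$, let $\xi$ be a non-zero Killing vector field on the unit sphere $\mathbb{S}^{2p}\subset\mathbb{R}^{2p+1}$ with its canonical metric, and let $F_\xi=\ker(r_\xi-\mathrm{Id})$ be its invariant axis, where $r_\xi$ is the flow of $\xi$. Then $\dim F_\xi=2k+1$ for some $0\le k\le p-1$, and there is a Kaluza-Klein metric $G$ on $T\mathbb{S}^{2p}$ with $A\equiv 1$ for which $\xi$ is a harmonic section if and only if (1) $k\ne p-1$, i.e. $\dim F_\xi$ is not maximal; and (2) in suitable orthonormal coordinates $(x_1,\dots,x_{2p+1})$ of $\mathbb{R}^{2p+1}$, $\xi=\lambda(-x_2,x_1,\dots,-x_{2p-2k},x_{2p-2k-1},0,\dots,0)$ with $\lambda$ a non-zero constant. When (1) and (2) hold, one possible choice for the functions defining $G$ is $C=0$ and $B(t)=Ke^{-\frac{(2p-1)t}{2\lambda^2(p-1-k)}}$ ($K>0$).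
   Context: Let $(M,g)$ be a Riemannian manifold with Levi-Civita connection $\nabla$. At $(p,e)\in TM$ the space $T_{(p,e)}TM$ splits into the vertical space (kernel of $d\pi$, $\pi:TM\to M$ the projection) and the horizontal space defined by $\nabla$; each $X\in T_pM$ has a horizontal lift $X^h$ and a vertical lift $X^v$. A Kaluza-Klein metric on $TM$ is a Riemannian metric $G$ such that at $(p,e)$ $$G(X^h,Y^h)=A(|e|^2)g(X,Y),\quad G(X^h,Y^v)=0,\quad G(X^v,Y^v)=B(|e|^2)g(X,Y)+C(|e|^2)g(X,e)g(Y,e),$$ where $A,B,C$ are real $C^2$ functions on $[0,\infty)$, $A>0$, and $B,C$ are such that $G$ is positive definite. A vector field $\sigma$ on $M$ is viewed as a map $\sigma:(M,g)\to(TM,G)$. Its tension field $\tau(\sigma)=\operatorname{trace}\nabla d\sigma$ (computed with the Levi-Civita connections of $g$ and $G$) is decomposed as $\tau(\sigma)=[\tau^h(\sigma)]^h+[\tau^v(\sigma)]^v$ with $\tau^h(\sigma),\tau^v(\sigma)$ vector fields on $M$. $\sigma$ is a harmonic section if $\tau^v(\sigma)=0$ (equivalently, it is critical for the energy with respect to variations through vector fields). The flow of a Killing field on a unit sphere extends to a one-parameter group of linear isometries of the ambient Euclidean space; $F_\xi$ is the linear subspace of vectors of the ambient space fixed by this whole flow. *)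

(* Defs.v *)
From HB Require Import structures.
From mathcomp Require Import all_boot all_order all_algebra.
From mathcomp Require Import all_classical all_reals all_analysis.

Set Implicit Arguments.
Unset Strict Implicit.
Unset Printing Implicit Defensive.

Import Order.TTheory GRing.Theory Num.Theory.
Import numFieldNormedType.Exports.

Local Open Scope classical_set_scope.
Local Open Scope ring_scope.

Section Coordinates.
Variable R : realType.

Definition partial n (i : 'I_n) (f : 'rV[R]_n -> R) (x : 'rV[R]_n) : R :=
  'D_(delta_mx 0 i) f x.

Fixpoint Ck n (m : nat) (f : 'rV[R]_n -> R) : Prop :=
  continuous f /\
  if m is m'.+1 then
    forall i : 'I_n, (forall x, derivable f x (delta_mx 0 i)) /\ Ck m' (partial i f)
  else True.

Definition smooth n (f : 'rV[R]_n -> R) : Prop := forall m, Ck m f.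

Definition bilin n (h : 'M[R]_n) (a b : 'rV[R]_n) : R := (a *m h *m b^T) 0 0.

(* A metric on a coordinate domain is given by its Gram matrix h; this is
   Gamma^k_(ij) of its Levi-Civita connection at x. *)
Definition christoffel n (h : 'rV[R]_n -> 'M[R]_n) (x : 'rV[R]_n)
    (k i j : 'I_n) : R :=
  2^-1 * \sum_l invmx (h x) k l *
    (partial i (fun y => h y j l) x + partial j (fun y => h y i l) x
     - partial l (fun y => h y i j) x).

(* Tension field, trace_g (nabla ds), of s : (R^n, g) -> (R^m, h). *)
Definition tension n m (g : 'rV[R]_n -> 'M[R]_n) (h : 'rV[R]_m -> 'M[R]_m)
    (s : 'rV[R]_n -> 'rV[R]_m) (x : 'rV[R]_n) : 'rV[R]_m :=
  \row_c \sum_i \sum_j invmx (g x) i j *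
    (partial i (partial j (fun y => s y 0 c)) x
     - (\sum_k christoffel g x k i j * partial k (fun y => s y 0 c) x)
     + \sum_a \sum_b christoffel h (s x) c a b
         * partial i (fun y => s y 0 a) x * partial j (fun y => s y 0 b) x).

(* A point of the tangent bundle has coordinates w = (u, v), v being the
   components of a vector at u.  A vector a tangent to the bundle at w is
   X^h + Y^v with X = d(pi)(a) = lsubmx a and Y = vertical g w a, where Y is
   the image of a under the connection map of g. *)
Definition vertical n (g : 'rV[R]_n -> 'M[R]_n) (w a : 'rV[R]_(n + n)) :
    'rV[R]_n :=
  rsubmx a + \row_k \sum_i \sum_j
    christoffel g (lsubmx w) k i j * lsubmx a 0 i * rsubmx w 0 j.

Definition kk_form n (g : 'rV[R]_n -> 'M[R]_n) (A B C : R -> R)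
    (w a b : 'rV[R]_(n + n)) : R :=
  let u := lsubmx w in
  let e := rsubmx w in
  let t := bilin (g u) e e in
  let Y := vertical g w a in
  let Z := vertical g w b in
  A t * bilin (g u) (lsubmx a) (lsubmx b) + B t * bilin (g u) Y Z
  + C t * bilin (g u) Y e * bilin (g u) Z e.

Definition kk_metric n (g : 'rV[R]_n -> 'M[R]_n) (A B C : R -> R)
    (w : 'rV[R]_(n + n)) : 'M[R]_(n + n) :=
  \matrix_(i, j) kk_form g A B C w (delta_mx 0 i) (delta_mx 0 j).

(* The vertical component of the tension field of the section u |-> (u, v u). *)
Definition vertical_tension n (g : 'rV[R]_n -> 'M[R]_n) (A B C : R -> R)
    (v : 'rV[R]_n -> 'rV[R]_n) (u : 'rV[R]_n) : 'rV[R]_n :=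
  let s := fun y => row_mx y (v y) in
  vertical g (s u) (tension g (kk_metric g A B C) s u).

(* Components of the Lie derivative of g along v. *)
Definition lie_metric n (g : 'rV[R]_n -> 'M[R]_n) (v : 'rV[R]_n -> 'rV[R]_n)
    (u : 'rV[R]_n) (i j : 'I_n) : R :=
  \sum_k (v u 0 k * partial k (fun y => g y i j) u
          + g u k j * partial i (fun y => v y 0 k) u
          + g u i k * partial j (fun y => v y 0 k) u).

Definition has_dim N (F : set 'rV[R]_N) (d : nat) : Prop :=
  exists U : {vspace 'rV[R]_N}, (forall w, w \in U <-> F w) /\ \dim U = d.

(* Derivatives on [0, +oo[ are one-sided at 0; values at negative arguments
   are irrelevant. *)
Definition derivative_on_nonneg (f f' : R -> R) : Prop :=
  forall t : R, 0 <= t ->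
    (f s - f t) / (s - t) @[s --> within [set s | 0 <= s] t^'] --> f' t.

Definition C2_on_nonneg (f : R -> R) : Prop :=
  exists f1 f2 : R -> R, [/\ derivative_on_nonneg f f1,
    derivative_on_nonneg f1 f2 &
    forall t : R, 0 <= t -> f2 s @[s --> within [set s | 0 <= s] (nbhs t)] --> f2 t].

End Coordinates.

Section Sphere.
Variables (R : realType) (n : nat).

Definition dot N (x y : 'rV[R]_N) : R := (x *m y^T) 0 0.

Definition orthogonal_mx N (Q : 'M[R]_N) : Prop := Q *m Q^T = 1%:M.

Definition on_sphere (x : 'rV[R]_n.+1) : Prop := dot x x = 1.

(* Inverse stereographic projection centred at row 0 of the orthogonal matrix
   Q (the image of u = 0), with axes along the remaining rows.  The image is
   the sphere minus the antipode of row 0 of Q. *)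
Definition stereo (Q : 'M[R]_n.+1) (u : 'rV[R]_n) : 'rV[R]_n.+1 :=
  (1 + dot u u)^-1 *:
    ((row_mx (1 - dot u u)%:M (2 *: u) : 'rV[R]_(1 + n)) *m Q).

Definition stereo_jacobian (Q : 'M[R]_n.+1) (u : 'rV[R]_n) : 'M[R]_(n, n.+1) :=
  \matrix_(i, j) partial i (fun y => stereo Q y 0 j) u.

(* The canonical (induced) metric of the sphere in the chart. *)
Definition sphere_metric (Q : 'M[R]_n.+1) (u : 'rV[R]_n) : 'M[R]_n :=
  stereo_jacobian Q u *m (stereo_jacobian Q u)^T.

(* The components v of the tangent vector xi (stereo Q u), i.e. the solution
   of v *m stereo_jacobian Q u = xi (stereo Q u). *)
Definition field_coords (Q : 'M[R]_n.+1) (xi : 'rV[R]_n.+1 -> 'rV[R]_n.+1)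
    (u : 'rV[R]_n) : 'rV[R]_n :=
  xi (stereo Q u) *m (stereo_jacobian Q u)^T *m invmx (sphere_metric Q u).

(* Only the values of xi on the sphere matter. *)
Definition vector_field (xi : 'rV[R]_n.+1 -> 'rV[R]_n.+1) : Prop :=
  (forall x, on_sphere x -> dot (xi x) x = 0) /\
  forall Q, orthogonal_mx Q ->
    forall i, smooth (fun u => field_coords Q xi u 0 i).

Definition killing (xi : 'rV[R]_n.+1 -> 'rV[R]_n.+1) : Prop :=
  vector_field xi /\
  forall Q, orthogonal_mx Q ->
    forall u i j, lie_metric (sphere_metric Q) (field_coords Q xi) u i j = 0.

Definition kaluza_klein (A B C : R -> R) : Prop :=
  [/\ [/\ C2_on_nonneg A, C2_on_nonneg B & C2_on_nonneg C],
      forall t : R, 0 <= t -> 0 < A t &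
      forall Q, orthogonal_mx Q -> forall w a : 'rV[R]_(n + n), a != 0 ->
        0 < bilin (kk_metric (sphere_metric Q) A B C w) a a].

(* The tension field does not depend on coordinates, so at each point x of the
   sphere it is computed in the charts centred at x = stereo Q 0. *)
Definition harmonic_section (A B C : R -> R)
    (xi : 'rV[R]_n.+1 -> 'rV[R]_n.+1) : Prop :=
  forall Q, orthogonal_mx Q ->
    vertical_tension (sphere_metric Q) A B C (field_coords Q xi) 0 = 0.

(* r is the one-parameter group of linear isometries x |-> x *m r t extending
   the flow of xi. *)
Definition linear_flow (xi : 'rV[R]_n.+1 -> 'rV[R]_n.+1) (r : R -> 'M[R]_n.+1) :
    Prop :=
  [/\ r 0 = 1%:M, forall s t, r (s + t) = r s *m r t,
      forall t, orthogonal_mx (r t) &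
      forall x, on_sphere x -> forall t : R,
        is_derive t 1 (fun s : R => x *m r s) (xi (x *m r t))].

Definition invariant_axis (xi : 'rV[R]_n.+1 -> 'rV[R]_n.+1) : set 'rV[R]_n.+1 :=
  [set w | exists r, linear_flow xi r /\ forall t, w *m r t = w].

(* (y_1, ..., y_(n+1)) |-> (-y_2, y_1, ..., -y_(2m), y_(2m-1), 0, ..., 0);
   indices in the code start at 0. *)
Definition rotation_field (m : nat) (y : 'rV[R]_n.+1) : 'rV[R]_n.+1 :=
  \row_(j < n.+1)
    if (j < 2 * m)%N then
      if odd j then y 0 (inord j.-1) else - y 0 (inord j.+1)
    else 0.

(* The rows of P are an orthonormal basis; x *m P^T are the coordinates of x
   in that basis. *)
Definition rotation_in_coords (m : nat) (lambda : R)
    (xi : 'rV[R]_n.+1 -> 'rV[R]_n.+1) : Prop :=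
  exists P : 'M[R]_n.+1, orthogonal_mx P /\
    forall x, on_sphere x ->
      xi x *m P^T = lambda *: rotation_field m (x *m P^T).

End Sphere.

(* Main.v *)
(* Along a great circle the scalar product of a Killing field with the velocity
   is constant.  Hence <xi y, x> = - <xi x, y> for all x, y on the sphere, and
   xi is the restriction of a skew-symmetric linear map W.  Its invariant axis
   is ker W, which has odd dimension because a skew matrix has even rank.

   Computing the tension field at the centre x of a stereographic chart, with
   A = 1, a = x W and t = |a|^2, its vertical part vanishes if and only if
     [(n-1)(B + t C) + (B' - C)(|W|^2 - 2t) - C' (|a W|^2 - t^2)] a
       + 2 B' (a W^2 + t a) = 0,
   the functions being evaluated at t.

   Tilting x towards the axis makes this equation available for a fixed
   direction of a and every small t > 0.  If W^3 is not a multiple of W, some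
   a is not an eigenvector of W^2, so B' = 0 near 0; two directions with
   distinct |a W|^2 / |a|^2 then give C' = 0, and the remaining equation, affine
   in t, forces B = C = 0.  So W^3 = - lambda^2 W, which puts W in the normal
   form of (2).  If W has rank 2, then at x in the image of W the equation
   reduces to B + t C = 0, against positive definiteness.  Conversely, for
   W^3 = - lambda^2 W and C = 0 it is a linear ODE for B solved by the
   exponential. *)

Require Import Defs.
From HB Require Import structures.
From mathcomp Require Import all_boot all_order all_algebra.
From mathcomp Require Import all_classical all_reals all_analysis.
From mathcomp Require Import ring lra zify.

Set Implicit Arguments.
Unset Strict Implicit.
Unset Printing Implicit Defensive.

Import Order.TTheory GRing.Theory Num.Theory.
Import numFieldNormedType.Exports.

Local Open Scope classical_set_scope.
Local Open Scope ring_scope.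

(** * Orthonormal families and skew-symmetric matrices *)

(** Stereographic charts are used because they are conformal: the Gram matrix of the sphere is
    scalar, so its inverse and Christoffel symbols are explicit, and a skew linear field becomes
    quadratic. At the centre the conformal factor is stationary with value 4 and the Christoffel
    symbols vanish, so only first derivatives of the bundle metric and the 2-jet of the section
    enter. The inverse of the [2n] by [2n] Gram matrix of the bundle is never computed: the tension
    field is paired with vertical vectors, which lowers the index, and positive definiteness
    recovers the vertical part. In passing from the chart back to [W], the corrections in t come
    from the normal component [- t x] of [a W]. A zero of the field gives t = 0, where B and C have
    one-sided derivatives only; affine extension to the negative axis makes them differentiable
    there. *)

Section LinearAlgebra.
Variable R : realType.

Lemma dotE N (x y : 'rV[R]_N) : dot x y = \sum_i x 0 i * y 0 i.
Proof. by rewrite /dot mxE; apply: eq_bigr => i _; rewrite mxE. Qed.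

Lemma dotC N (x y : 'rV[R]_N) : dot x y = dot y x.
Proof. by rewrite !dotE; apply: eq_bigr => i _; rewrite mulrC. Qed.

Lemma dotDl N (x y z : 'rV[R]_N) : dot (x + y) z = dot x z + dot y z.
Proof. by rewrite /dot mulmxDl mxE. Qed.

Lemma dotDr N (x y z : 'rV[R]_N) : dot z (x + y) = dot z x + dot z y.
Proof. by rewrite dotC dotDl !(dotC z). Qed.

Lemma dotZl N (a : R) (x z : 'rV[R]_N) : dot (a *: x) z = a * dot x z.
Proof. by rewrite /dot -scalemxAl mxE. Qed.

Lemma dotZr N (a : R) (x z : 'rV[R]_N) : dot z (a *: x) = a * dot z x.
Proof. by rewrite dotC dotZl dotC. Qed.

Lemma dotNl N (x z : 'rV[R]_N) : dot (- x) z = - dot x z.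
Proof. by rewrite -scaleN1r dotZl mulN1r. Qed.

Lemma dotNr N (x z : 'rV[R]_N) : dot z (- x) = - dot z x.
Proof. by rewrite dotC dotNl dotC. Qed.

Lemma dot0l N (z : 'rV[R]_N) : dot 0 z = 0.
Proof. by rewrite -(scale0r 0) dotZl mul0r. Qed.

Lemma dot0r N (z : 'rV[R]_N) : dot z 0 = 0.
Proof. by rewrite dotC dot0l. Qed.

Lemma dot_mulmx N M (A : 'M[R]_(N, M)) x y : dot (x *m A) y = dot x (y *m A^T).
Proof. by rewrite /dot trmx_mul trmxK mulmxA. Qed.

Lemma dot_ge0 N (x : 'rV[R]_N) : 0 <= dot x x.
Proof. by rewrite dotE sumr_ge0 // => i _; rewrite -expr2 sqr_ge0. Qed.

Lemma dot_eq0 N (x : 'rV[R]_N) : (dot x x == 0) = (x == 0).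
Proof.
apply/eqP/eqP => [|->]; last by rewrite dot0l.
rewrite dotE => /psumr_eq0P x0; apply/rowP => i; rewrite mxE.
have /eqP := x0 (fun i _ => ltac:(by rewrite -expr2 sqr_ge0)) i isT.
by rewrite mulf_eq0 orbb => /eqP.
Qed.

Lemma dot_gt0 N (x : 'rV[R]_N) : (0 < dot x x) = (x != 0).
Proof. by rewrite lt_neqAle dot_ge0 andbT eq_sym dot_eq0. Qed.

Lemma dot_deltal N (x : 'rV[R]_N) i : dot (delta_mx 0 i) x = x 0 i.
Proof.
rewrite dotE (bigD1 i) //= !mxE !eqxx mul1r big1 ?addr0 // => j ji.
by rewrite !mxE eqxx (negbTE ji) mul0r.
Qed.

Lemma dot_deltar N (x : 'rV[R]_N) i : dot x (delta_mx 0 i) = x 0 i.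
Proof. by rewrite dotC dot_deltal. Qed.

Lemma dot_inj N (x y : 'rV[R]_N) : (forall z, dot x z = dot y z) -> x = y.
Proof. by move=> xy; apply/rowP => i; rewrite -!dot_deltar. Qed.

Lemma orthogonal_mxC N (Q : 'M[R]_N) : orthogonal_mx Q -> Q^T *m Q = 1%:M.
Proof. exact: mulmx1C. Qed.

Lemma dot_orthogonal N (Q : 'M[R]_N) x y :
  orthogonal_mx Q -> dot (x *m Q) (y *m Q) = dot x y.
Proof. by move=> Qo; rewrite dot_mulmx -mulmxA Qo mulmx1. Qed.

Lemma exists_unit_multiple N (v : 'rV[R]_N) :
  v != 0 -> exists2 c : R, 0 < c & dot (c *: v) (c *: v) = 1.
Proof.
rewrite -dot_gt0 => v0; exists (Num.sqrt (dot v v))^-1.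
  by rewrite invr_gt0 sqrtr_gt0.
rewrite dotZl dotZr mulrA -invfM -expr2 sqr_sqrtr ?ltW // mulVf //.
by rewrite gt_eqF.
Qed.

(** Families are indexed by [nat], only the first [m] values being constrained, so that extending a
    family involves no change of index type. *)
Definition orthonormal N (m : nat) (f : nat -> 'rV[R]_N) : Prop :=
  forall a b, (a < m)%N -> (b < m)%N -> dot (f a) (f b) = (a == b)%:R.

Lemma orthonormal_rcons N m (f : nat -> 'rV[R]_N) v :
  orthonormal m f -> (forall a, (a < m)%N -> dot v (f a) = 0) ->
  dot v v = 1 -> orthonormal m.+1 (fun a => if a == m then v else f a).
Proof.
move=> fo vf vv a b; rewrite !ltnS => am bm.
case: (eqVneq a m) am => [->|am'] am; case: (eqVneq b m) bm => [->|bm'] bm //.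
- by rewrite vf ?ltn_neqAle ?bm' // eq_sym (negbTE bm').
- by rewrite dotC vf ?ltn_neqAle ?am' // (negbTE am').
- by rewrite fo // ltn_neqAle ?am' ?bm'.
Qed.

Lemma dot_rows0 N m (f : nat -> 'rV[R]_N) v :
  v *m (\matrix_(a < m) f a)^T = 0 -> forall a, (a < m)%N -> dot v (f a) = 0.
Proof.
move=> vf a am; move/matrixP/(_ 0 (Ordinal am)): vf; rewrite !mxE => <-.
by rewrite dotE; apply: eq_bigr => i _; rewrite !mxE.
Qed.

Lemma exists_orthogonal_vector N m (f : nat -> 'rV[R]_N) : (m < N)%N ->
  exists2 v, v != 0 & forall a, (a < m)%N -> dot v (f a) = 0.
Proof.
move=> mN; pose A := (\matrix_(a < m) f a)^T; pose K := kermx A.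
have /rowV0Pn[v /sub_kermxP vA v0] : K != 0.
  rewrite -mxrank_eq0 mxrank_ker -lt0n subn_gt0.
  by apply: leq_ltn_trans mN; rewrite rank_leq_col.
by exists v => // a; apply: dot_rows0.
Qed.

Lemma orthonormal_extend N m (f : nat -> 'rV[R]_N) :
  (m <= N)%N -> orthonormal m f ->
  exists2 g, orthonormal N g & forall a, (a < m)%N -> g a = f a.
Proof.
move: {2}(N - m)%N (erefl (N - m)%N) => d; elim: d m f => [|d IH] m f dE mN fo.
  by exists f => // a b aN bN; apply: fo; lia.
have mN' : (m < N)%N by lia.
have [v v0 vf] := exists_orthogonal_vector f mN'.
have [c c0 cv] := exists_unit_multiple v0.
have cvf a : (a < m)%N -> dot (c *: v) (f a) = 0.
  by move=> am; rewrite dotZl vf // mulr0.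
have [|g go gf] := IH m.+1 _ _ mN' (orthonormal_rcons fo cvf cv); first lia.
by exists g => // a am; rewrite gf ?ltn_eqF // ltnS ltnW.
Qed.

Lemma orthonormal_mx N (g : nat -> 'rV[R]_N) :
  orthonormal N g -> orthogonal_mx (\matrix_(i < N) g i).
Proof.
move=> go; apply/matrixP => i j; have := go i j (ltn_ord i) (ltn_ord j).
by rewrite !mxE val_eqE dotE => <-; apply: eq_bigr => k _; rewrite !mxE.
Qed.

Lemma exists_orthogonal_row0 n (x : 'rV[R]_n.+1) :
  dot x x = 1 -> exists2 Q, orthogonal_mx Q & row 0 Q = x.
Proof.
move=> xx; have o1 : orthonormal 1 (fun=> x) by move=> [|//] [|//] _ _.
have [//|g go gx] := orthonormal_extend _ o1.
exists (\matrix_(i < n.+1) g i); first exact: orthonormal_mx.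
by rewrite rowK gx.
Qed.

Lemma exists_orthogonal_row01 n (x z : 'rV[R]_n.+2) :
  dot x x = 1 -> dot z z = 1 -> dot x z = 0 ->
  exists Q, [/\ orthogonal_mx Q, row 0 Q = x & row (lift 0 0) Q = z].
Proof.
move=> xx zz xz.
have o2 : orthonormal 2 (fun a => if a == 0%N then x else z).
  by move=> [|[|//]] [|[|//]] _ _ //=; rewrite dotC.
have [//|g go gx] := orthonormal_extend _ o2.
exists (\matrix_(i < n.+2) g i).
by split; [exact: orthonormal_mx| rewrite rowK gx..].
Qed.

Definition skew N (W : 'M[R]_N) : Prop := W^T = - W.

Lemma skew_dot N (W : 'M[R]_N) x y :
  skew W -> dot (x *m W) y = - dot x (y *m W).
Proof. by move=> Ws; rewrite dot_mulmx Ws mulmxN dotNr. Qed.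

Lemma skew_dotxx N (W : 'M[R]_N) x : skew W -> dot (x *m W) x = 0.
Proof. by move=> Ws; have := skew_dot x x Ws; rewrite (dotC x); lra. Qed.

(** [|x W|^2 = - <x, x W^2>]. So [W^2] and [W] have the same kernel, which lets a factor [W] be
    cancelled on the right. *)
Lemma skew_sq_eq0 N (W : 'M[R]_N) (x : 'rV[R]_N) : skew W -> x *m W *m W = 0 -> x *m W = 0.
Proof.
move=> Ws xWW; apply/eqP; rewrite -dot_eq0.
by rewrite skew_dot // xWW dot0r oppr0.
Qed.

(** The compression [S = B W B^T] of [W] to its row space is skew and, as [W] and [W^2] have the
    same kernel, invertible. With r the rank, [det S = det S^T = (-1)^r det S] excludes odd r. *)
Lemma skew_rank_even N (W : 'M[R]_N) : skew W -> ~~ odd (\rank W).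
Proof.
move=> Ws; move: (row_base W) (eq_row_base W) (row_base_free W) => B eqBW Bfree.
pose S := B *m W *m B^T.
have /submxP[D BD] : (B <= W)%MS by rewrite eqBW.
have /submxP[E WE] : (W <= B)%MS by rewrite eqBW.
have St : S^T = - S.
  by rewrite /S !trmx_mul trmxK Ws mulNmx mulmxN mulmxA.
have : S \in unitmx.
  rewrite -row_free_unit -kermx_eq0; apply/rowV0P => v.
  move=> /sub_kermxP vS.
  have B0 : v *m B *m W *m B^T = 0 by rewrite -vS /S !mulmxA.
  have W0 : v *m B *m W *m W = 0.
    have: v *m B *m W *m (B^T *m E^T) = 0 by rewrite mulmxA B0 mul0mx.
    by rewrite -trmx_mul -WE Ws mulmxN => /eqP; rewrite oppr_eq0 => /eqP.
  have {}W0 : v *m B *m W = 0 by apply: skew_sq_eq0.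
  have {}W0 : v *m D *m W = 0.
    by apply: skew_sq_eq0 => //; rewrite -[v *m D *m W]mulmxA -BD.
  have vB : v *m B = 0 by rewrite BD mulmxA.
  move: Bfree; rewrite -kermx_eq0 => /eqP kerB.
  by have /sub_kermxP := vB; rewrite kerB submx0 => /eqP.
rewrite unitmxE unitfE; apply: contraNN => odd_r.
have := det_tr S; rewrite St -scaleN1r detZ -signr_odd odd_r expr1 mulN1r.
by move/eqP; rewrite eq_sym -addr_eq0 -mulr2n mulrn_eq0.
Qed.

(** Bridge between the rank of a matrix and the [vspace] dimension of [has_dim]: the rows of a base
    of [kermx W] form a free family. *)
Lemma has_dim_ker N (W : 'M[R]_N) :
  has_dim [set w : 'rV[R]_N | w *m W = 0]%classic (N - \rank W).
Proof.
pose K := kermx W; pose B := row_base K; pose X := [tuple row i B | i < \rank K].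
have BW : B *m W = 0 by apply/sub_kermxP; rewrite eq_row_base.
have Xi (i : 'I_(\rank K)) : X`_i = row i B.
  by rewrite -(tnth_nth 0 X i) tnth_mktuple.
exists <<X>>%VS; split=> [w|].
  split=> [/coord_span -> /=|/= wW].
    rewrite mulmx_suml big1 // => i _.
    by rewrite Xi -scalemxAl -row_mul BW linear0 scaler0.
  have /submxP[D ->] : (w <= B)%MS by rewrite eq_row_base; apply/sub_kermxP.
  rewrite mulmx_sum_row; apply: memv_suml => i _; apply: memvZ.
  by rewrite -Xi; apply: memv_span; rewrite mem_nth // size_tuple.
have /eqP -> : free X; last by rewrite size_tuple mxrank_ker.
apply/freeP => k Xk i.
have /row_free_inj Binj : row_free B by apply: row_base_free.
have : \row_i k i *m B = 0 *m B.
  by rewrite mul0mx mulmx_sum_row -[RHS]Xk; apply: eq_bigr => j _; rewrite mxE Xi.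
by move=> /Binj/rowP/(_ i); rewrite !mxE.
Qed.

End LinearAlgebra.

(** * Normal form of a skew matrix with a single frequency *)

Section NormalForm.
Variable R : realType.

(** With the [f a] as columns of [A], [rank (W A) <= m < rank W], so the kernel of [W A] is not
    contained in that of [W]. *)
Lemma exists_image_orthogonal N (W : 'M[R]_N) m (f : nat -> 'rV[R]_N) :
  (m < \rank W)%N ->
  exists2 w, w *m W != 0 & forall a, (a < m)%N -> dot (w *m W) (f a) = 0.
Proof.
move=> mW; pose A := (\matrix_(a < m) f a)^T.
have [w] : exists w : 'rV_N, (w <= kermx (W *m A))%MS && ~~ (w <= kermx W)%MS.
  apply: contrapT => /forallNP wP.
  have /mxrankS : (kermx (W *m A) <= kermx W)%MS.
    by apply/rV_subP => w wA; apply: contrapT => /negP wW; apply: (wP w); rewrite wA.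
  rewrite !mxrank_ker.
  have : (\rank (W *m A) <= m)%N.
    exact: leq_trans (mxrankM_maxr W A) (rank_leq_col A).
  by have := rank_leq_col W; lia.
rewrite !sub_kermx => /andP[/eqP wA wW]; exists w => // a.
by apply: dot_rows0; rewrite -mulmxA.
Qed.

(** Each step takes a unit vector [v] in the image of [W], where [W^2] acts as [- lambda^2],
    orthogonal to the planes already found, and pairs it with [u = lambda^-1 v W]. *)
Lemma skew_rotation_pairs N (W : 'M[R]_N) (lambda : R) i :
  skew W -> lambda != 0 -> W *m W *m W = - lambda ^+ 2 *: W ->
  (2 * i <= \rank W)%N ->
  exists2 f : nat -> 'rV[R]_N, orthonormal (2 * i) f &
    forall a, (a < i)%N -> f (2 * a)%N *m W = lambda *: f (2 * a).+1 /\
      f (2 * a).+1 *m W = - lambda *: f (2 * a)%N.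
Proof.
move=> Ws l0 W3; elim: i => [|i IH] iW; first by exists (fun=> 0).
have [|f fo fW] := IH; first lia.
have [|w w0 wf] := @exists_image_orthogonal _ W (2 * i) f; first lia.
have [c c0 vv] := exists_unit_multiple w0.
set v := c *: (w *m W) in vv.
have vf a : (a < 2 * i)%N -> dot v (f a) = 0 by move=> ai; rewrite dotZl wf ?mulr0.
have vWW : v *m W *m W = - lambda ^+ 2 *: v.
  rewrite /v -!scalemxAl -!mulmxA (mulmxA W) W3 -scalemxAr !scalerA.
  by rewrite mulrC.
pose u := lambda^-1 *: (v *m W).
have uW : u *m W = - lambda *: v.
  by rewrite /u -scalemxAl vWW scalerA; congr (_ *: _); field.
have uu : dot u u = 1.
  rewrite dotZl dotZr skew_dot // vWW dotZr vv; field.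
  exact: l0.
have uv : dot u v = 0 by rewrite dotZl skew_dotxx ?mulr0.
(* By skewness [v] is tested against [f a *m W], a multiple of the partner of [f a], to which [v] is
   orthogonal. *)
have uf a : (a < 2 * i)%N -> dot u (f a) = 0.
  move=> ai; rewrite dotZl skew_dot // -(odd_double_half a) -mul2n.
  have [fe fo'] : f (2 * a./2)%N *m W = lambda *: f (2 * a./2).+1 /\
    f (2 * a./2).+1 *m W = - lambda *: f (2 * a./2)%N by apply: fW; lia.
  by case: (odd a); rewrite ?add1n ?add0n ?fe ?fo' dotZr vf ?mulr0 ?oppr0 ?mulr0 //; lia.
pose f1 a := if a == (2 * i)%N then v else f a.
pose f2 a := if a == (2 * i).+1 then u else f1 a.
have o1 : orthonormal (2 * i).+1 f1 by apply: orthonormal_rcons.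
have o2 : orthonormal (2 * i).+2 f2.
  apply: orthonormal_rcons => // a; rewrite ltnS leq_eqVlt /f1.
  by case: (eqVneq a (2 * i)%N) => //= _ ai; apply: uf.
exists f2; first by rewrite (_ : (2 * i.+1 = (2 * i).+2)%N) //; lia.
move=> a; rewrite ltnS leq_eqVlt => /orP[/eqP ->|ai].
  rewrite /f2 /f1 !eqxx !(ifN_eq, ifN_eqC) ?eqxx; try by apply/eqP; lia.
  by rewrite uW /u scalerA divff // scale1r.
have [fe fo'] := fW a ai.
by rewrite /f2 /f1 !ifN_eq ?fe ?fo' //; apply/eqP; lia.
Qed.

Lemma skew_normal_form n (W : 'M[R]_n.+1) (lambda : R) m :
  skew W -> lambda != 0 -> W *m W *m W = - lambda ^+ 2 *: W ->
  \rank W = (2 * m)%N ->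
  exists2 P, orthogonal_mx P &
    forall x : 'rV_n.+1, x *m W *m P^T = lambda *: rotation_field m (x *m P^T).
Proof.
move=> Ws l0 W3 rW.
have [|f fo fW] := @skew_rotation_pairs _ W lambda m Ws l0 W3; first by rewrite rW.
have mn : (2 * m <= n.+1)%N by rewrite -rW rank_leq_col.
have [g go gf] := orthonormal_extend mn fo.
pose A := \matrix_(a < (2 * m)%N) f a.
have AA : A *m A^T = 1%:M.
  apply/matrixP => a b; have := fo a b (ltn_ord a) (ltn_ord b).
  rewrite !mxE val_eqE dotE => <-.
  by apply: eq_bigr => k _; rewrite !mxE.
have AW : (A <= W)%MS.
  apply/row_subP => a; rewrite rowK.
  have [fe fo'] : f (2 * a./2)%N *m W = lambda *: f (2 * a./2).+1 /\
    f (2 * a./2).+1 *m W = - lambda *: f (2 * a./2)%N.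
    by apply: fW; have := ltn_ord a; lia.
  rewrite -(odd_double_half a) -mul2n; case: (odd a); rewrite ?add1n ?add0n.
    by rewrite -[f _](scalerK l0) -fe scalemxAl submxMl.
  rewrite -[f _](@scalerK _ _ (- lambda)) ?oppr_eq0 //.
  by rewrite -fo' scalemxAl submxMl.
have rA : \rank A = (2 * m)%N.
  apply/eqP; rewrite eqn_leq rank_leq_row /= -[X in (X <= _)%N](@mxrank1 R).
  by rewrite -AA mxrankM_maxl.
have /submxP[D WD] : (W <= A)%MS.
  by rewrite -(geq_leqif (mxrank_leqif_sup AW)) rA rW.
(* The [f a] span the row space of [W] by equality of ranks, so a vector orthogonal to them is
   killed by [W^T = - W]. *)
have gW j : (2 * m <= j < n.+1)%N -> g j *m W = 0.
  move=> /andP[mj jn]; apply/eqP; rewrite -oppr_eq0 -mulmxN -Ws WD trmx_mul mulmxA.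
  suff -> : g j *m A^T = 0 by rewrite mul0mx.
  apply/rowP => a; have := go j a jn (leq_trans (ltn_ord a) mn).
  rewrite (gf a) // gtn_eqF ?(leq_trans _ mj) //= dotE => ga.
  by rewrite !mxE -[RHS]ga; apply: eq_bigr => k _; rewrite !mxE.
have PE (P := \matrix_(i < n.+1) g i) (y : 'rV_n.+1) (j : 'I_n.+1) :
    (y *m P^T) 0 j = dot y (g j).
  by rewrite mxE dotE; apply: eq_bigr => k _; rewrite !mxE.
exists (\matrix_(i < n.+1) g i); first exact: orthonormal_mx.
move=> x; apply/rowP => j; rewrite PE skew_dot // [RHS]mxE [in RHS]mxE.
case: ifP => jm; last first.
  by rewrite gW ?dot0r ?mulr0 ?oppr0 // ltn_ord andbT leqNgt jm.
have [fe fo'] : f (2 * j./2)%N *m W = lambda *: f (2 * j./2).+1 /\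
  f (2 * j./2).+1 *m W = - lambda *: f (2 * j./2)%N by apply: fW; lia.
have jE := odd_double_half j; rewrite -mul2n in jE.
rewrite gf //; case: ifP => jo; rewrite jo in jE.
  have jE1 : j.-1 = (2 * j./2)%N by lia.
  rewrite -{1}jE add1n fo' PE inordK; last by have := ltn_ord j; lia.
  by rewrite jE1 gf ?dotZr; [ring|lia].
have jE1 : j.+1 = (2 * j./2).+1 by lia.
rewrite -{1}jE add0n fe PE inordK; last by lia.
by rewrite jE1 gf ?dotZr; [ring|lia].
Qed.

End NormalForm.

(** * Directional derivatives *)

Section DirectionalDerivatives.
Variables (R : realType) (V : normedModType R).
Implicit Types (f g : V -> R) (x v : V).

Lemma is_derive_cstE x v (c : R) : is_derive x v (fun=> c) 0.
Proof. exact: is_derive_cst. Qed.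

Lemma is_derive_add f g x v df dg : is_derive x v f df -> is_derive x v g dg ->
  is_derive x v (fun y => f y + g y) (df + dg).
Proof. by move=> fd gd; exact: (is_deriveD fd gd). Qed.

Lemma is_derive_opp f x v df : is_derive x v f df ->
  is_derive x v (fun y => - f y) (- df).
Proof. by move=> fd; exact: (is_deriveN fd). Qed.

Lemma is_derive_sub f g x v df dg : is_derive x v f df -> is_derive x v g dg ->
  is_derive x v (fun y => f y - g y) (df - dg).
Proof. by move=> fd gd; apply: is_derive_add => //; apply: is_derive_opp. Qed.

Lemma is_derive_mul f g x v df dg : is_derive x v f df -> is_derive x v g dg ->
  is_derive x v (fun y => f y * g y) (df * g x + f x * dg).
Proof.
move=> fd gd; apply: is_derive_eq (is_deriveM fd gd) _.
by rewrite addrC /GRing.scale /= (mulrC (g x)).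
Qed.

Lemma is_derive_inv f x v df : f x != 0 -> is_derive x v f df ->
  is_derive x v (fun y => (f y)^-1) (- df / f x ^+ 2).
Proof.
move=> fx0 [fd fE]; apply: DeriveDef; first exact: derivableV.
by rewrite deriveV // fE /GRing.scale /= mulNr mulrC mulNr.
Qed.

Lemma is_derive_bigsum I (r : seq I) (F : I -> V -> R) (dF : I -> R) x v :
  (forall i, is_derive x v (F i) (dF i)) ->
  is_derive x v (fun y => \sum_(i <- r) F i y) (\sum_(i <- r) dF i).
Proof.
move=> Fd; elim: r => [|i r IH].
  rewrite big_nil; under eq_fun do rewrite big_nil; exact: is_derive_cstE.
rewrite big_cons; under eq_fun do rewrite big_cons; exact: is_derive_add.
Qed.

(** Restriction to the line along [v] gives a function of one real variable; the chain rule on [R]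
    then applies, and a partial derivative becomes an ordinary one along a chart line. *)
Lemma is_derive_lineP f x v (s d : R) :
  is_derive (s *: v + x) v f d <-> is_derive s 1 (fun h : R => f (h *: v + x)) d.
Proof.
have E : (fun h : R => h^-1 *: ((f \o shift (s *: v + x)) (h *: v)
            - f (s *: v + x))) =
         (fun h : R => h^-1 *: (((fun h : R => f (h *: v + x)) \o shift s) (h *: 1)
            - f (s *: v + x))).
  apply/funext => h /=; congr (_ *: (f _ - _)).
  by rewrite addrA -scalerDl [h *: 1]mulr1.
by split=> -[fd fE]; (apply: DeriveDef;
  [move: fd; rewrite /derivable E|move: fE; rewrite /derive E]).
Qed.

Lemma is_derive_chain (h : R -> R) f x v dh df :
  is_derive (f x) 1 h dh -> is_derive x v f df ->
  is_derive x v (fun y => h (f y)) (dh * df).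
Proof.
move=> hd fd; rewrite -[x]add0r -(scale0r v); apply/is_derive_lineP.
apply: (@is_derive1_comp _ h (fun s : R => f (s *: v + x))).
  by rewrite scale0r add0r.
by apply/is_derive_lineP; rewrite scale0r add0r.
Qed.

Lemma is_derive_dot N (F G : V -> 'rV[R]_N) (dF dG : 'rV[R]_N) x v :
  (forall j, is_derive x v (fun y => F y 0 j) (dF 0 j)) ->
  (forall j, is_derive x v (fun y => G y 0 j) (dG 0 j)) ->
  is_derive x v (fun y => dot (F y) (G y)) (dot dF (G x) + dot (F x) dG).
Proof.
move=> Fd Gd; under eq_fun do rewrite dotE.
rewrite !dotE -big_split /=; apply: is_derive_bigsum => j.
exact: is_derive_mul.
Qed.

Lemma is_derive_rV N (F : V -> 'rV[R]_N) (dF : 'rV[R]_N) x v :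
  (forall j, is_derive x v (fun y => F y 0 j) (dF 0 j)) -> is_derive x v F dF.
Proof.
move=> Fd; have Fdiff : derivable F x v.
  by apply/derivable_mxP => i j; rewrite ord1; have [] := Fd j.
apply: DeriveDef => //; rewrite derive_mx //; apply/rowP => j; rewrite mxE.
by have [] := Fd j.
Qed.

End DirectionalDerivatives.

Section RowVectorDerivatives.
Variables (R : realType) (n : nat).
Implicit Types x v : 'rV[R]_n.

Lemma is_derive_coord x v j : is_derive x v (fun y : 'rV[R]_n => y 0 j) (v 0 j).
Proof.
have E : (fun h : R => h^-1 *: (((fun y : 'rV[R]_n => y 0 j) \o shift x) (h *: v)
            - x 0 j)) @ 0^' --> v 0 j.
  apply: cvg_near_cst; near=> h.
  rewrite /= !mxE addrK /GRing.scale /= mulKf //.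
  by near: h; exact: nbhs_dnbhs_neq.
apply: DeriveDef; first by apply/cvg_ex; exists (v 0 j).
exact: cvg_lim E.
Unshelve. all: by end_near. Qed.

Lemma partialE i (f : 'rV[R]_n -> R) x d :
  is_derive x (delta_mx 0 i) f d -> partial i f x = d.
Proof. by move=> [_ <-]. Qed.

Lemma is_derive_sqnorm x v :
  is_derive x v (fun y : 'rV[R]_n => dot y y) (2 * dot x v).
Proof.
apply: is_derive_eq (is_derive_dot (is_derive_coord x v) (is_derive_coord x v)) _.
by rewrite dotC mulr2n mulrDl mul1r.
Qed.

End RowVectorDerivatives.

(** * Stereographic charts *)

Section Chart.
Variables (R : realType) (n : nat) (Q : 'M[R]_n.+1).
Hypothesis Qo : orthogonal_mx Q.

(* The chart [stereo P] is centred at [pole P]; the rows of [axes P] span the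
   tangent space there. *)
Definition pole (P : 'M[R]_n.+1) : 'rV[R]_n.+1 := row 0 P.

Definition axes (P : 'M[R]_n.+1) : 'M[R]_(n, n.+1) := \matrix_i row (lift 0 i) P.

Lemma stereoE u : stereo Q u =
  ((1 - dot u u) / (1 + dot u u)) *: pole Q + (2 / (1 + dot u u)) *: (u *m axes Q).
Proof.
have rl : row_mx (1 - dot u u)%:M (2 *: u) 0 (ord0 : 'I_(1 + n)) = 1 - dot u u.
  have -> : (ord0 : 'I_(1 + n)) = lshift n ord0 by apply: val_inj.
  by rewrite row_mxEl mxE eqxx mulr1n.
have rr i : row_mx (1 - dot u u)%:M (2 *: u) 0 (lift ord0 i : 'I_(1 + n)) = 2 * u 0 i.
  have -> : (lift ord0 i : 'I_(1 + n)) = rshift 1 i by apply: val_inj.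
  by rewrite row_mxEr mxE.
apply/rowP => j; rewrite !mxE big_ord_recl rl.
under eq_bigr do rewrite rr -mulrA.
rewrite -mulr_sumr mulrDr; congr (_ + _); first by rewrite mulrA (mulrC _^-1).
rewrite mulrA (mulrC _^-1); congr (_ * _).
by apply: eq_bigr => i _; rewrite !mxE.
Qed.

Lemma dot_pole : dot (pole Q) (pole Q) = 1.
Proof.
have /matrixP/(_ 0 0) := Qo; rewrite !mxE eqxx mulr1n => <-.
by rewrite dotE; apply: eq_bigr => i _; rewrite !mxE.
Qed.

Lemma pole_axes : pole Q *m (axes Q)^T = 0.
Proof.
apply/rowP => i; have /matrixP/(_ 0 (lift 0 i)) := Qo.
rewrite !mxE -[X in _ = X -> _]/(0 : R) => Q0; rewrite -[RHS]Q0.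
 by apply: eq_bigr => j _; rewrite !mxE.
Qed.

Lemma axes_axes : axes Q *m (axes Q)^T = 1%:M.
Proof.
apply/matrixP => i j; have /matrixP/(_ (lift 0 i) (lift 0 j)) := Qo.
rewrite !mxE (inj_eq lift_inj) => <-; by apply: eq_bigr => k _; rewrite !mxE.
Qed.

Lemma dot_pole_axes a : dot (pole Q) (a *m axes Q) = 0.
Proof. by rewrite dotC dot_mulmx pole_axes dot0r. Qed.

Lemma dot_axes a b : dot (a *m axes Q) (b *m axes Q) = dot a b.
Proof. by rewrite dot_mulmx -mulmxA axes_axes mulmx1. Qed.

Lemma pole_axes_decomp x :
  x = dot x (pole Q) *: pole Q + x *m (axes Q)^T *m axes Q.
Proof.
rewrite -[LHS]mulmx1 -(orthogonal_mxC Qo) mulmxA; apply/rowP => j.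
rewrite !mxE big_ord_recl; congr (_ + _).
  by congr (_ * _); rewrite mxE dotE; apply: eq_bigr => i _; rewrite !mxE.
apply: eq_bigr => i _; rewrite !mxE; congr (_ * _).
by apply: eq_bigr => k _; rewrite !mxE.
Qed.

Lemma sqnorm1_gt0 N (u : 'rV[R]_N) : 0 < 1 + dot u u.
Proof. by rewrite ltr_pwDl ?dot_ge0. Qed.

Lemma sqnorm1_neq0 N (u : 'rV[R]_N) : 1 + dot u u != 0.
Proof. by rewrite gt_eqF ?sqnorm1_gt0. Qed.

Lemma stereo_on_sphere u : on_sphere (stereo Q u).
Proof.
rewrite /on_sphere stereoE !dotDl !dotDr !dotZl !dotZr dot_pole dot_axes.
rewrite (dotC _ (pole Q)) dot_pole_axes.
have := sqnorm1_neq0 u; set r := dot u u => D0; by field.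
Qed.

(* The differential of [stereo Q] at [u], in the direction [a]. *)
Definition stereo_diff (u a : 'rV[R]_n) : 'rV[R]_n.+1 :=
  (- (4 * dot u a / (1 + dot u u) ^+ 2)) *: pole Q
  + ((2 / (1 + dot u u)) *: a - (4 * dot u a / (1 + dot u u) ^+ 2) *: u) *m axes Q.

Lemma stereo_is_derive u a j :
  is_derive u a (fun y => stereo Q y 0 j) (stereo_diff u a 0 j).
Proof.
have D0 := sqnorm1_neq0 u.
have rd := is_derive_sqnorm u a.
have Dd := is_derive_add (is_derive_cstE u a 1) rd.
have Vd := @is_derive_inv _ _ (fun y : 'rV_n => 1 + dot y y) u a _ D0 Dd.
have ud : is_derive u a (fun y => (y *m axes Q) 0 j) ((a *m axes Q) 0 j).
  under eq_fun do rewrite mxE.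
  rewrite mxE; apply: is_derive_bigsum => i.
  apply: is_derive_eq (is_derive_mul (is_derive_coord u a i)
    (is_derive_cstE u a (axes Q i j))) _.
  by rewrite mulr0 addr0.
have E : (fun y => stereo Q y 0 j) = (fun y => ((1 - dot y y) * (1 + dot y y)^-1)
    * pole Q 0 j + (2 * (1 + dot y y)^-1) * (y *m axes Q) 0 j).
  by apply/funext => y; rewrite stereoE mxE; congr (_ + _); rewrite mxE.
have d1 := is_derive_mul (is_derive_sub (is_derive_cstE u a 1) rd) Vd.
have d2 := is_derive_mul (is_derive_cstE u a 2) Vd.
have d3 := is_derive_mul d1 (is_derive_cstE u a (pole Q 0 j)).
rewrite E; apply: is_derive_eq (is_derive_add d3 (is_derive_mul d2 ud)) _.
rewrite /stereo_diff mulmxBl -!scalemxAl !mxE.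
set s := \sum_(_ < _) _; set t := \sum_(_ < _) _.
by field.
Qed.

Lemma stereo_diff_is_linear u : linear (stereo_diff u).
Proof.
move=> k a b; rewrite /stereo_diff dotDr dotZr; apply/rowP => j.
rewrite !mulmxBl -!scalemxAl mulmxDl -scalemxAl !mxE; ring.
Qed.

Lemma stereo_jacobianE u a : a *m stereo_jacobian Q u = stereo_diff u a.
Proof.
rewrite {2}(row_sum_delta a).
pose f := GRing.isLinear.Build _ _ _ _ _ (stereo_diff_is_linear u).
pose g : {linear 'rV[R]_n -> 'rV[R]_n.+1} := HB.pack (stereo_diff u) f.
rewrite -[stereo_diff u]/(g : _ -> _) linear_sum /=.
apply/rowP => j; rewrite mxE summxE; apply: eq_bigr => i _.
rewrite mxE -[stereo_diff u]/(g : _ -> _) linearZ mxE; congr (_ * _).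
exact: partialE (stereo_is_derive _ _ _).
Qed.

Definition conformal_factor (u : 'rV[R]_n) : R := 4 / (1 + dot u u) ^+ 2.

Lemma conformal_factor_gt0 u : 0 < conformal_factor u.
Proof. by rewrite divr_gt0 // exprn_gt0 // sqnorm1_gt0. Qed.

(** Conformality of stereographic projection: the pole is orthogonal to the axes, and the terms in
    [<u, a> <u, b>] cancel. *)
Lemma dot_stereo_diff u a b :
  dot (stereo_diff u a) (stereo_diff u b) = conformal_factor u * dot a b.
Proof.
rewrite /stereo_diff !(dotDl, dotDr, dotZl, dotZr, dot_axes, dot_pole, dotNl, dotNr).
rewrite (dotC _ (pole Q)) !dot_pole_axes (dotC a u) /conformal_factor.
by have := sqnorm1_neq0 u; set r := dot u u => D0; field.
Qed.

Lemma sphere_metricE u : sphere_metric Q u = (conformal_factor u)%:M.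
Proof.
have E a b : dot (a *m sphere_metric Q u) b = conformal_factor u * dot a b.
  by rewrite mulmxA dot_mulmx trmxK !stereo_jacobianE dot_stereo_diff.
apply/row_matrixP => i; apply: dot_inj => z.
by rewrite !rowE E mul_mx_scalar dotZl.
Qed.

End Chart.

Section SphereGeometry.
Variables (R : realType) (n : nat) (Q : 'M[R]_n.+1).
Hypothesis Qo : orthogonal_mx Q.

Lemma conformal_factor_is_derive (u a : 'rV[R]_n) :
  is_derive u a (@conformal_factor R n) (- (16 * dot u a) / (1 + dot u u) ^+ 3).
Proof.
have D0 := sqnorm1_neq0 u.
have Dd := is_derive_add (is_derive_cstE u a 1) (is_derive_sqnorm u a).
have D20 : (1 + dot u u) * (1 + dot u u) != 0 by rewrite mulf_neq0.
have Vd := @is_derive_inv _ _ (fun y : 'rV_n => (1 + dot y y) * (1 + dot y y))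
  u a _ D20 (is_derive_mul Dd Dd).
have -> : @conformal_factor R n =
    (fun y => 4 * ((1 + dot y y) * (1 + dot y y))^-1).
  by apply/funext => y; rewrite /conformal_factor expr2.
apply: is_derive_eq (is_derive_mul (is_derive_cstE u a 4) Vd) _.
by move: D0; set r := dot u u => D0; field.
Qed.

Lemma partial_sphere_metric u (i j l : 'I_n) :
  partial i (fun y => sphere_metric Q y j l) u =
  (- (16 * u 0 i) / (1 + dot u u) ^+ 3) * (j == l)%:R.
Proof.
have -> : (fun y => sphere_metric Q y j l) =
    (fun y => conformal_factor y * (j == l)%:R).
  by apply/funext => y; rewrite sphere_metricE // mxE mulr_natr.
rewrite -[u 0 i]dot_deltar; apply: partialE.
apply: is_derive_eq (is_derive_mul (conformal_factor_is_derive _ _)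
  (is_derive_cstE _ _ _)) _.
by rewrite mulr0 addr0.
Qed.

Lemma sphere_metric_coef u (i j : 'I_n) :
  sphere_metric Q u i j = conformal_factor u * (i == j)%:R.
Proof. by rewrite sphere_metricE // mxE mulr_natr. Qed.

Lemma christoffel_sphere u (k i j : 'I_n) :
  christoffel (sphere_metric Q) u k i j =
  - (2 / (1 + dot u u)) * ((j == k)%:R * u 0 i + (i == k)%:R * u 0 j
                          - (i == j)%:R * u 0 k).
Proof.
rewrite /christoffel sphere_metricE // invmx_scalar (bigD1 k) //= big1 => [|l lk].
  rewrite !partial_sphere_metric !mxE eqxx mulr1n /conformal_factor.
  by have := sqnorm1_neq0 u; set r := dot u u => D0; field.
by rewrite mxE eq_sym (negbTE lk) mul0r.
Qed.

(* The vector with components [Gamma^k_(ij) a_i e_j] in a chart. *)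
Definition christoffel_form (u a e : 'rV[R]_n) : 'rV[R]_n :=
  - (2 / (1 + dot u u)) *: (dot u a *: e + dot u e *: a - dot a e *: u).

Lemma sum_delta (I : finType) (f : I -> R) k : \sum_j (j == k)%:R * f j = f k.
Proof.
rewrite (bigD1 k) //= eqxx mul1r big1 ?addr0 // => j /negbTE ->.
by rewrite mul0r.
Qed.

Lemma verticalE w a : vertical (sphere_metric Q) w a =
  rsubmx a + christoffel_form (lsubmx w) (lsubmx a) (rsubmx w).
Proof.
rewrite /vertical /christoffel_form; congr (_ + _).
move: (lsubmx w) (lsubmx a) (rsubmx w) => u b e; apply/rowP => k.
rewrite !mxE; under eq_bigr => i _.
  under eq_bigr => j _.
    rewrite christoffel_sphere.
    rewrite (_ : _ * _ * _ = - (2 / (1 + dot u u)) *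
      ((j == k)%:R * (u 0 i * b 0 i * e 0 j)
       + (i == k)%:R * b 0 i * (u 0 j * e 0 j)
       - b 0 i * u 0 k * ((j == i)%:R * e 0 j))); last by rewrite (eq_sym j i); ring.
  over.
  rewrite -mulr_sumr sumrB big_split /= sum_delta -mulr_sumr -dotE -mulr_sumr sum_delta.
over.
rewrite -mulr_sumr; congr (_ * _); rewrite sumrB big_split /=.
rewrite -mulr_suml -dotE -mulr_suml sum_delta; congr (_ + _ - _); first by rewrite mulrC.
by rewrite dotE mulr_suml; apply: eq_bigr => i _; ring.
Qed.

Section LinearField.
Variables (W : 'M[R]_n.+1) (xi : 'rV[R]_n.+1 -> 'rV[R]_n.+1).
Hypothesis Ws : skew W.
Hypothesis xiW : forall x, on_sphere x -> xi x = x *m W.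

(* For [x = pole Q], [field_center] holds the coordinates of [x *m W] along the
   axes, and [field_rot] is the compression of [W] to the tangent space at [x]. *)
Definition field_center : 'rV[R]_n := pole Q *m W *m (axes Q)^T.

Definition field_rot : 'M[R]_n := axes Q *m W *m (axes Q)^T.

Lemma field_rot_skew : skew field_rot.
Proof. by rewrite /skew !trmx_mul trmxK Ws mulNmx mulmxN mulmxA. Qed.

(** A skew linear field is quadratic in a stereographic chart, which makes its 2-jet at the centre
    explicit. The identity is checked after pairing both sides with [stereo_diff Q u a], where
    skewness removes the terms [<y W, y>]. *)
Lemma field_coordsE u : field_coords Q xi u =
  u *m field_rot + ((1 - dot u u) / 2) *: field_center + dot u field_center *: u.
Proof.
rewrite /field_coords sphere_metricE // invmx_scalar mul_mx_scalar xiW; last first.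
  exact: stereo_on_sphere.
have c0 := conformal_factor_gt0 u.
apply: (scalerI (lt0r_neq0 c0)); rewrite scalerA divff ?scale1r ?gt_eqF //.
apply: dot_inj => a.
rewrite dot_mulmx trmxK stereo_jacobianE // stereoE //.
have uM : dot (u *m axes Q *m W) (u *m axes Q) = 0 by rewrite skew_dotxx.
have pp : dot (pole Q *m W) (pole Q) = 0 by rewrite skew_dotxx.
have up v : dot (v *m axes Q *m W) (pole Q) = - dot v field_center.
  by rewrite skew_dot // dot_mulmx.
have pu v : dot (pole Q *m W) (v *m axes Q) = dot v field_center.
  by rewrite dotC dot_mulmx.
have ua : dot (u *m axes Q *m W) (a *m axes Q) = dot (u *m field_rot) a.
  by rewrite dotC dot_mulmx dotC /field_rot !mulmxA.
rewrite /stereo_diff /conformal_factor mulmxBl mulmxDl -!scalemxAl.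
rewrite !(dotDl, dotDr, dotZl, dotZr, dotNl, dotNr) uM pp !up !pu ua.
rewrite (dotC u a) (dotC field_center a).
by have := sqnorm1_neq0 u; set r := dot u u => D0; field.
Qed.

End LinearField.
End SphereGeometry.

(** * Killing fields on the sphere are linear *)

Section AlongGreatCircle.
Variables (R : realType) (n : nat) (Q : 'M[R]_n.+2) (v : 'rV[R]_n.+1 -> 'rV[R]_n.+1).
Hypothesis Qo : orthogonal_mx Q.
Let d : 'rV[R]_n.+1 := delta_mx 0 0.
Hypothesis v_derivable : forall u, derivable (fun u => v u 0 0) u d.
Hypothesis v_killing : forall u, lie_metric (sphere_metric Q) v u 0 0 = 0.

(* The chart line [s |-> s d] parametrises a great circle. *)
Lemma killing_radial_ode (s : R) :
  is_derive s 1 (fun h : R => v (h *: d) 0 0) (2 * s * v (s *: d) 0 0 / (1 + s ^+ 2)).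
Proof.
have vd0 : is_derive (s *: d + 0) d (fun u => v u 0 0) (partial 0 (fun u => v u 0 0) (s *: d)).
  by rewrite addr0; apply: derivableP.
have -> : (fun h : R => v (h *: d) 0 0) = (fun h => v (h *: d + 0) 0 0).
  by apply/funext => h; rewrite addr0.
apply: is_derive_eq ((is_derive_lineP (fun u => v u 0 0) 0 d s _).1 vd0) _.
have := v_killing (s *: d); rewrite /lie_metric.
(* At [u = s d] the derivative of [g_00] along axis [k] is proportional to [u_k], so only [k = 0]
   contributes and the equation closes on the single component [v_0]. *)
under eq_bigr => k _.
  rewrite partial_sphere_metric // !sphere_metric_coef // mxE eqxx (eq_sym 0 k).
  have -> : d 0 k = (k == 0)%:R by rewrite mxE eqxx.
  rewrite (_ : _ + _ = (k == 0)%:R * (v (s *: d) 0 k *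
     (- (16 * s) / (1 + dot (s *: d) (s *: d)) ^+ 3) +
     2 * conformal_factor (s *: d) * partial 0 (fun y => v y 0 k) (s *: d))); last first.
    by case: eqP => _; rewrite ?mulr1n ?mulr0n; ring.
over.
rewrite sum_delta /conformal_factor !dotZl !dotZr dot_deltal mxE !eqxx mulr1.
rewrite -expr2; set p := partial _ _ _; set q := v _ _ _.
have D0 : 1 + s ^+ 2 != 0 by rewrite gt_eqF // ltr_pwDl // sqr_ge0.
move=> E; apply: (mulfI (_ : 8 / (1 + s ^+ 2) ^+ 2 != 0)).
  by rewrite mulf_neq0 ?invr_eq0 ?expf_neq0.
transitivity (16 * s * q / (1 + s ^+ 2) ^+ 3); last by field.
apply/eqP; rewrite -subr_eq0 -E; apply/eqP; field.
exact: D0.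
Qed.

(** [v_0 / (1 + s^2)] has zero derivative. Up to a factor 2 it is the product of the field with the
    unit velocity of the great circle, the conserved quantity of a Killing field along a
    geodesic. *)
Lemma killing_radial (s : R) : v (s *: d) 0 0 = (1 + s ^+ 2) * v 0 0 0.
Proof.
have D0 (h : R) : 1 + h ^+ 2 != 0 by rewrite gt_eqF // ltr_pwDl // sqr_ge0.
pose f h : R := v (h *: d) 0 0 * (1 + h * h)^-1.
have fd (h : R) : is_derive h 1 f 0.
  have hd : is_derive h (1 : R) (fun y : R => 1 + y * y) (0 + (1 * h + h * 1)).
    have id_der := is_derive_id h (1 : R).
    exact: is_derive_add (is_derive_cstE h 1 1) (is_derive_mul id_der id_der).
  have h0 : 1 + h * h != 0 by rewrite -expr2.
  have Vd := @is_derive_inv _ _ (fun y : R => 1 + y * y) h 1 _ h0 hd.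
  apply: is_derive_eq (is_derive_mul (killing_radial_ode h) Vd) _.
  by move: h0; set q := v _ _ _ => h0; field.
have := is_derive_0_is_cst s 0 fd; rewrite /f scale0r mulr0 addr0 invr1 mulr1 => <-.
by rewrite mulrC -expr2 divfK.
Qed.

End AlongGreatCircle.

Lemma dot_field_coords (R : realType) n (Q : 'M[R]_n.+1) xi u a : orthogonal_mx Q ->
  conformal_factor u * dot (field_coords Q xi u) a = dot (xi (stereo Q u)) (stereo_diff Q u a).
Proof.
move=> Qo; rewrite /field_coords sphere_metricE // invmx_scalar mul_mx_scalar dotZl.
rewrite mulrA divff ?mul1r ?gt_eqF ?conformal_factor_gt0 //.
by rewrite dot_mulmx trmxK stereo_jacobianE.
Qed.

(** With [s] the tangent of the half angle, [y] is the point of the chart line for pole [x] and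
    first axis [z]. Conservation and tangency at [y] determine [<xi y, x>]. *)
Lemma killing_great_circle (R : realType) n (xi : 'rV[R]_n.+2 -> 'rV[R]_n.+2) x z (s : R) :
  killing xi -> on_sphere x -> on_sphere z -> dot x z = 0 ->
  let y := ((1 - s ^+ 2) / (1 + s ^+ 2)) *: x + (2 * s / (1 + s ^+ 2)) *: z in
  dot (xi y) x = - dot (xi x) y.
Proof.
move=> [[xi_tangent xi_smooth] xi_lie] xx zz xz y.
have [Q [Qo Q0 Q1]] := exists_orthogonal_row01 xx zz xz.
pose d : 'rV[R]_n.+1 := delta_mx 0 0.
have dd : dot d d = 1 by rewrite dot_deltal mxE !eqxx.
have daxes : d *m axes Q = z.
  by rewrite -rowE rowK.
have D0 (h : R) : 1 + h ^+ 2 != 0 by rewrite gt_eqF // ltr_pwDl // sqr_ge0.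
pose gamma (h : R) := ((1 - h ^+ 2) / (1 + h ^+ 2)) *: x + (2 * h / (1 + h ^+ 2)) *: z.
have gammaE h : stereo Q (h *: d) = gamma h.
  rewrite stereoE // -scalemxAl daxes /pole Q0 !dotZl !dotZr dd mulr1 -expr2 scalerA.
  by rewrite mulrAC.
have gamma_sphere h : on_sphere (gamma h) by rewrite -gammaE; apply: stereo_on_sphere.
have [v rad vxi] : exists2 v : 'rV[R]_n.+1 -> 'rV[R]_n.+1,
    forall h, v (h *: d) 0 0 = (1 + h ^+ 2) * v 0 0 0 &
    forall u a, conformal_factor u * dot (v u) a = dot (xi (stereo Q u)) (stereo_diff Q u a).
  exists (field_coords Q xi) => [h|u a]; last exact: dot_field_coords.
  apply: (killing_radial Qo) => u; last exact: xi_lie.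
  by have /= [_ /(_ 0)[vd _]] := xi_smooth Q Qo 0 1%N.
(* The product of the field with the chart velocity, computed in two ways: by the conservation law,
   and from the ambient differential of [stereo]. *)
have proj h : 4 / (1 + h ^+ 2) * v 0 0 0 =
    - (4 * h / (1 + h ^+ 2) ^+ 2) * dot (xi (gamma h)) x
    + (2 / (1 + h ^+ 2) - 4 * h ^+ 2 / (1 + h ^+ 2) ^+ 2) * dot (xi (gamma h)) z.
  have dv : dot (v (h *: d)) d = v (h *: d) 0 0 by apply: dot_deltar.
  have := vxi (h *: d) d; rewrite dv rad gammaE /stereo_diff /conformal_factor.
  rewrite mulmxBl -!scalemxAl daxes /pole Q0 dotDr dotZr dotDr dotNr !dotZr !dotZl.
  rewrite dd !mulr1 -expr2 => E.
  transitivity (4 / (1 + h ^+ 2) ^+ 2 * ((1 + h ^+ 2) * v 0 0 0)).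
    by have := D0 h; set D := 1 + _ => ?; field.
  by rewrite E; ring.
have gamma0 : gamma 0 = x.
  by rewrite /gamma expr0n /= subr0 addr0 divr1 mulr0 mul0r scale0r addr0 scale1r.
have := proj 0; rewrite gamma0 expr0n /= addr0 expr1n !(mulr0, mul0r) oppr0 mul0r add0r.
rewrite !(invr1, mulr1, subr0, oppr0, mulr0, mul0r, add0r) => v0.
have := proj s; have := xi_tangent _ (gamma_sphere s); have := xi_tangent _ xx.
rewrite {2}/gamma -/y dotDr !dotZr /y => xi_x tang vs.
rewrite dotDr !dotZr xi_x mulr0 add0r.
have {}v0 : dot (xi x) z = 2 * v 0 0 0 by lra.
rewrite v0.
move: tang vs; rewrite -/(gamma s).
set a := dot _ x; set b := dot _ z; set w := v _ _ _.
have Ds := D0 s => tang vs.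
have {}tang : (1 - s ^+ 2) * a + 2 * s * b = 0.
  rewrite -[RHS](mulr0 (1 + s ^+ 2)) -tang; field.
  exact: Ds.
have {}vs : 4 * (1 + s ^+ 2) * w = - (4 * s) * a + 2 * (1 - s ^+ 2) * b.
  transitivity ((1 + s ^+ 2) ^+ 2 * (4 / (1 + s ^+ 2) * w)); first by field.
  rewrite vs; field.
  exact: Ds.
(* Two linear equations in [a = <xi y, x>] and [b = <xi y, z>] are at hand; the combination below
   eliminates [b]. *)
apply: (mulfI (expf_neq0 2 Ds)).
transitivity (- s * (4 * (1 + s ^+ 2) * w)); last by field.
rewrite vs; apply/eqP; rewrite -subr_eq0; apply/eqP.
transitivity ((1 - s ^+ 2) * ((1 - s ^+ 2) * a + 2 * s * b)); first by ring.
by rewrite tang mulr0.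
Qed.

(** If [y] is a multiple of [x], both sides vanish by tangency. Otherwise [y] lies on a great circle
    through [x], at the parameter [s = sin / (1 + cos)], finite because [y <> - x]. *)
Lemma killing_antisym (R : realType) n (xi : 'rV[R]_n.+2 -> 'rV[R]_n.+2) x y :
  killing xi -> on_sphere x -> on_sphere y -> dot (xi y) x = - dot (xi x) y.
Proof.
rewrite /on_sphere => xiK xx yy; have [[xi_tangent _] _] := xiK.
set c := dot y x.
have [w yE wx] : exists2 w, y = c *: x + w & dot x w = 0.
  exists (y - c *: x); first by rewrite addrC subrK.
  by rewrite dotDr dotNr dotZr xx mulr1 dotC subrr.
have ww : dot w w = 1 - c ^+ 2.
  rewrite -[X in X - _]yy {1 2}yE.
  by rewrite !(dotDl, dotDr, dotZl, dotZr) (dotC w x) wx xx; ring.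
case: (eqVneq w 0) => [w0|w0].
  have {}yE : y = c *: x by rewrite yE w0 addr0.
  have c0 : c != 0.
    by apply/negP => /eqP c0; have := ww; rewrite w0 dot0l c0; lra.
  rewrite {2}yE dotZr (xi_tangent x) // mulr0 oppr0.
  by apply: (mulfI c0); rewrite -dotZr -yE xi_tangent ?mulr0.
have ww0 : 0 < 1 - c ^+ 2 by rewrite -ww dot_gt0.
have c1 : 0 < 1 + c by nra.
have [q q0 qq] : exists2 q, 0 < q & q ^+ 2 = 1 - c ^+ 2.
  by exists (Num.sqrt (1 - c ^+ 2)); rewrite ?sqrtr_gt0 // sqr_sqrtr // ltW.
pose s := q / (1 + c); pose z := q^-1 *: w.
have zz : on_sphere z.
  rewrite /on_sphere dotZl dotZr ww -qq; field.
  by rewrite gt_eqF.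
have xz : dot x z = 0 by rewrite dotZr wx mulr0.
have := killing_great_circle s xiK xx zz xz => /=.
suff -> : ((1 - s ^+ 2) / (1 + s ^+ 2)) *: x + (2 * s / (1 + s ^+ 2)) *: z = y by [].
have sE : 1 + s ^+ 2 = 2 / (1 + c).
  rewrite /s expr_div_n qq; field.
  by rewrite gt_eqF.
rewrite sE yE /z scalerA; congr (_ *: _ + _).
  rewrite /s expr_div_n qq; field.
  by rewrite !gt_eqF.
rewrite -[RHS]scale1r; congr (_ *: _); rewrite /s; field.
by rewrite !gt_eqF.
Qed.

(** [<xi x, e_j> = - <xi e_j, x>] is already linear in [x]; the rows of the matrix are the values of
    [xi] on the canonical basis. *)
Lemma killing_linear (R : realType) n (xi : 'rV[R]_n.+2 -> 'rV[R]_n.+2) :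
  killing xi ->
  exists2 W, skew W & forall x, on_sphere x -> xi x = x *m W.
Proof.
move=> xiK; pose e i : 'rV[R]_n.+2 := delta_mx 0 i.
have ee i : on_sphere (e i) by rewrite /on_sphere dot_deltal mxE !eqxx.
exists (\matrix_(i, j) xi (e i) 0 j) => [|x xx].
  apply/matrixP => i j; rewrite !mxE -[LHS]dot_deltar -[X in _ = - X]dot_deltar.
  exact: killing_antisym.
apply/rowP => j; rewrite -[LHS]dot_deltar (killing_antisym xiK (ee j) xx).
rewrite mxE dotE -sumrN; apply: eq_bigr => i _.
rewrite !mxE -[xi (e i) 0 j]dot_deltar (killing_antisym xiK (ee j) (ee i)).
by rewrite dot_deltar; ring.
Qed.

(** * The linear flow and the invariant axis *)

Section MatrixExponential.
Variables (R : realType) (n : nat) (W : 'M[R]_n.+1).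

Let mass : R := \sum_i \sum_j `|W i j|.

Lemma mxpow_entry_bound k i j : `|(W ^+ k) i j| <= mass ^+ k.
Proof.
elim: k i j => [|k IH] i j.
  by rewrite !expr0 mxE; case: eqP => _; rewrite ?normr1 ?normr0 ?ler01.
rewrite !exprSr mxE (le_trans (ler_norm_sum _ _ _)) // /mass mulr_sumr.
apply: ler_sum => l _; rewrite normrM ler_pM // (bigD1 j) //= lerDl.
by rewrite sumr_ge0.
Qed.

(* The shift [a] is the number of termwise differentiations. *)
Definition expmx_coef (a : nat) i j (k : nat) : R := (W ^+ (k + a)) i j / k`!%:R.

Lemma expmx_coef_diffs a i j :
  pseries_diffs (expmx_coef a i j) = expmx_coef a.+1 i j.
Proof.
apply/funext => k; rewrite /pseries_diffs /expmx_coef factS natrM addnS addSn.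
have k0 : k`!%:R != 0 :> R by rewrite pnatr_eq0 -lt0n fact_gt0.
have k1 : k.+1%:R != 0 :> R by rewrite pnatr_eq0.
by rewrite invfM mulrCA mulVKf.
Qed.

(** Termwise domination by [mass ^+ a] times the exponential series of [mass * |x|]. *)
Lemma is_cvg_expmx a i j (x : R) : cvgn (pseries (expmx_coef a i j) x).
Proof.
apply: normed_cvg.
have m0 : 0 <= mass by rewrite sumr_ge0 // => k _; rewrite sumr_ge0.
apply: (@series_le_cvg _ _ (mass ^+ a *: exp_coeff (mass * `|x|))) => [k|k|k|].
- exact: normr_ge0.
- by rewrite mulr_ge0 ?exprn_ge0 // mulr_ge0 ?invr_ge0 // exprn_ge0 ?mulr_ge0.
- rewrite /expmx_coef /= !normrM normfV (ger0_norm (ler0n _ _)) normrX.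
  rewrite [leRHS](_ : _ = mass ^+ (k + a) * k`!%:R^-1 * `|x| ^+ k).
    by rewrite !ler_wpM2r ?exprn_ge0 ?invr_ge0 // mxpow_entry_bound.
  rewrite -[LHS]/(mass ^+ a * ((mass * `|x|) ^+ k / k`!%:R)) exprD exprMn; ring.
- by apply: is_cvg_seriesZ; apply: is_cvg_series_exp_coeff.
Qed.

Definition expmx (t : R) : 'M[R]_n.+1 :=
  \matrix_(i, j) limn (pseries (expmx_coef 0 i j) t).

Lemma expmx0 : expmx 0 = 1%:M.
Proof.
apply/matrixP => i j; rewrite !mxE; apply: cvg_lim => //.
apply: cvg_near_cst; exists 1%N => // k /= k1.
rewrite /pseries /series /= -(prednK k1) big_nat_recl // big1 ?addr0.
  by rewrite expr0 mulr1 /expmx_coef addn0 expr0 mxE fact0 divr1.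
by move=> l _; rewrite exprS mul0r mulr0.
Qed.

Lemma expmx_entry_is_derive (t : R) i j :
  is_derive t (1 : R) (fun s : R => expmx s i j) ((expmx t *m W) i j).
Proof.
have -> : (fun s : R => expmx s i j) = fun s => limn (pseries (expmx_coef 0 i j) s).
  by apply/funext => s; rewrite mxE.
have -> : (expmx t *m W) i j = limn (pseries (pseries_diffs (expmx_coef 0 i j)) t).
  rewrite expmx_coef_diffs mxE; apply/esym; apply: cvg_lim => //.
  have -> : pseries (expmx_coef 1 i j) t =
      fun k => \sum_l pseries (expmx_coef 0 i l) t k * W l j.
    apply/funext => k; rewrite /pseries /series /=.
    under [RHS]eq_bigr do rewrite mulr_suml.
    rewrite exchange_big /=; apply: eq_bigr => m _.
    rewrite /expmx_coef addn1 addn0 exprSr mxE !mulr_suml.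
    by apply: eq_bigr => l _; ring.
  apply: cvg_big => [|l _]; first exact: add_continuous.
  by rewrite mxE; apply: cvgMr_tmp; exact: is_cvg_expmx.
apply: (@pseries_snd_diffs _ _ (`|t| + 1)); rewrite ?expmx_coef_diffs;
  try exact: is_cvg_expmx.
by rewrite [ltRHS]ger0_norm// addrC -subr_gt0 addrK.
Qed.

End MatrixExponential.

Section SkewFlow.
Variables (R : realType) (n : nat) (W : 'M[R]_n.+1).
Hypothesis Ws : skew W.

Lemma row_expmx_is_derive (x : 'rV[R]_n.+1) (t : R) j :
  is_derive t (1 : R) (fun s : R => (x *m expmx W s) 0 j) ((x *m expmx W t *m W) 0 j).
Proof.
under eq_fun do rewrite mxE.
rewrite -mulmxA mxE; apply: is_derive_bigsum => i.
apply: is_derive_eq (is_derive_mul (is_derive_cstE t 1 (x 0 i))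
  (expmx_entry_is_derive W t i j)) _.
by rewrite mul0r add0r.
Qed.

(* Skewness makes the norm of a solution constant; group law, orthogonality and
   fixed vectors of the flow all follow from this uniqueness. *)
Lemma skew_ode_eq0 (y : R -> 'rV[R]_n.+1) :
  (forall (t : R) j, is_derive t (1 : R) (fun s => y s 0 j) ((y t *m W) 0 j)) ->
  y 0 = 0 -> forall t, y t = 0.
Proof.
move=> yd y0 t; have fd (s : R) : is_derive s (1 : R) (fun s => dot (y s) (y s)) 0.
  apply: is_derive_eq (is_derive_dot (yd s) (yd s)) _.
  by rewrite [X in _ + X]dotC skew_dotxx // addr0.
by apply/eqP; rewrite -dot_eq0 (is_derive_0_is_cst t 0 fd) y0 dot0l.
Qed.

Lemma expmx_orthogonal t : orthogonal_mx (expmx W t).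
Proof.
apply/row_matrixP => i; apply: dot_inj => z.
rewrite !rowE mulmx1 mulmxA dot_mulmx trmxK.
have fd (s : R) : is_derive s (1 : R)
    (fun s => dot (delta_mx 0 i *m expmx W s) (z *m expmx W s)) 0.
  apply: is_derive_eq (is_derive_dot (row_expmx_is_derive _ s)
    (row_expmx_is_derive _ s)) _.
  by rewrite skew_dot // addNr.
by rewrite (is_derive_0_is_cst t 0 fd) expmx0 !mulmx1.
Qed.

Lemma expmxD s t : expmx W (s + t) = expmx W s *m expmx W t.
Proof.
apply/row_matrixP => i; rewrite !rowE mulmxA; apply/eqP; rewrite -subr_eq0.
pose x : 'rV[R]_n.+1 := delta_mx 0 i.
apply/eqP; apply: (@skew_ode_eq0
  (fun t => x *m expmx W (s + t) - x *m expmx W s *m expmx W t)) => [u j|].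
  have sd : is_derive u (1 : R) (fun y : R => s + y) 1.
    apply: is_derive_eq (is_derive_add (is_derive_cstE u (1 : R) s) (is_derive_id u (1 : R))) _.
    by rewrite add0r.
  have xd : is_derive u (1 : R) (fun y : R => (x *m expmx W (s + y)) 0 j)
      ((x *m expmx W (s + u) *m W) 0 j * 1).
    exact: (@is_derive_chain _ _ (fun y : R => (x *m expmx W y) 0 j)
      (fun y : R => s + y) _ _ _ _ (row_expmx_is_derive x (s + u) j) sd).
  rewrite /=.
  have -> : (fun y : R => (x *m expmx W (s + y) - x *m expmx W s *m expmx W y) 0 j) =
      (fun y => (x *m expmx W (s + y)) 0 j - (x *m expmx W s *m expmx W y) 0 j).
    by apply/funext => y; rewrite !mxE.
  apply: is_derive_eq (is_derive_sub xd (row_expmx_is_derive (x *m expmx W s) u j)) _.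
  by rewrite mulr1 mulmxBl [RHS]mxE [X in _ = _ + X]mxE.
by rewrite addr0 expmx0 mulmx1 subrr.
Qed.

Lemma expmx_fix (w : 'rV[R]_n.+1) t : w *m W = 0 -> w *m expmx W t = w.
Proof.
move=> wW; apply/eqP; rewrite -subr_eq0; apply/eqP.
apply: (@skew_ode_eq0 (fun t => w *m expmx W t - w)) => [u j|].
  have -> : (fun y : R => (w *m expmx W y - w) 0 j) =
      (fun y => (w *m expmx W y) 0 j - w 0 j).
    by apply/funext => y; rewrite mxE [X in _ + X = _]mxE.
  apply: is_derive_eq (is_derive_sub (row_expmx_is_derive w u j)
    (is_derive_cstE u (1 : R) (w 0 j))) _.
  by rewrite subr0 mulmxBl wW subr0.
by rewrite expmx0 mulmx1 subrr.
Qed.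

(** Whatever flow [r] is given, differentiating the constant curve [w *m r t] at 0 gives
    [w *m W = 0], after normalising [w] since [linear_flow] speaks of the sphere only. For the
    converse a flow must be exhibited: [expmx W]. *)
Lemma invariant_axisE xi : (forall x, on_sphere x -> xi x = x *m W) ->
  forall w, invariant_axis xi w <-> w *m W = 0.
Proof.
move=> xiW w; split=> [[r [[r0 _ _ flow] rw]]|wW].
  case: (eqVneq w 0) => [->|/exists_unit_multiple[c c0 xx]]; first by rewrite mul0mx.
  have := flow (c *: w) xx 0; rewrite r0 mulmx1 xiW //.
  have -> : (fun s : R => c *: w *m r s) = cst (c *: w).
    by apply/funext => s; rewrite -scalemxAl rw.
  move=> [_]; rewrite derive_cst => /eqP.
  by rewrite eq_sym -scalemxAl scaler_eq0 gt_eqF //= => /eqP.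
exists (expmx W); split=> [|t]; last exact: expmx_fix.
split; [exact: expmx0|exact: expmxD|exact: expmx_orthogonal|].
move=> x xx t; rewrite xiW.
  by apply: is_derive_rV => j; exact: row_expmx_is_derive.
by rewrite /on_sphere dot_orthogonal //; exact: expmx_orthogonal.
Qed.

End SkewFlow.

(** * The Kaluza-Klein metric at the centre of a chart *)

Section OneSidedDerivatives.
Variable R : realType.

Lemma derivative_on_nonneg_ball (f f' : R -> R) t e :
  derivative_on_nonneg f f' -> 0 <= t -> 0 < e ->
  exists2 d, 0 < d & forall s, `|t - s| < d -> s != t -> 0 <= s ->
    `|f' t - (f s - f t) / (s - t)| <= e.
Proof.
move=> fd t0 e0; have /cvgrPdist_le/(_ e e0) := fd t t0.
rewrite near_withinE => -[d /= d0 dP]; by exists d.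
Qed.

Definition extend_nonneg (f f' : R -> R) (s : R) : R :=
  if 0 <= s then f s else f 0 + f' 0 * s.

(* The one-sided derivative at 0 becomes two-sided for the affine extension. *)
Lemma extend_nonneg_is_derive (f f' : R -> R) (t : R) :
  derivative_on_nonneg f f' -> 0 <= t ->
  is_derive t (1 : R) (extend_nonneg f f') (f' t).
Proof.
move=> fd t0; set F := extend_nonneg f f'.
have cv : (fun h : R => h^-1 *: ((F \o shift t) (h *: (1 : R)) - F t)) @ 0^' --> f' t.
  apply/cvgrPdist_le => e e0.
  have [d d0 dP] := derivative_on_nonneg_ball fd t0 e0.
  (* The affine branch can matter only at [t = 0]: for [t > 0], the radius [t] keeps [h + t]
     positive. *)
  have [d' d'0 d'P] : exists2 d', 0 < d' & forall h : R, `|h| < d' -> h + t < 0 -> t = 0.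
    case: (eqVneq t 0) => [->|tn0]; first by exists 1.
    exists t; first by rewrite lt_neqAle eq_sym tn0.
    by move=> h /ltr_normlP[]; lra.
  near=> h.
  have h0 : h != 0 by near: h; exact: nbhs_dnbhs_neq.
  have hd : `|h| < d by near: h; exact: dnbhs0_lt.
  have hd' : `|h| < d' by near: h; exact: dnbhs0_lt.
  rewrite /= [h *: 1]mulr1 /GRing.scale /= /F /extend_nonneg t0.
  case: ifPn => ht.
    have := dP (h + t); rewrite addrK mulrC; apply => //.
      by rewrite opprD addrCA subrr addr0 normrN.
    by rewrite -subr_eq0 addrK.
  rewrite -ltNge in ht; have tE := d'P h hd' ht; rewrite tE addr0.
  by rewrite [f 0 + _]addrC addrK mulrCA mulVf // mulr1 subrr normr0 ltW.
apply: DeriveDef; first by apply/cvg_ex; exists (f' t).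
exact: cvg_lim cv.
Unshelve. all: by end_near. Qed.

(** Because [h >= 0], composing with [f] or with its affine extension is the same; this covers
    points where [h] vanishes. *)
Lemma is_derive_comp_nonneg (V : normedModType R) (f f' : R -> R) (h : V -> R) x v dh :
  derivative_on_nonneg f f' -> (forall y, 0 <= h y) -> is_derive x v h dh ->
  is_derive x v (fun y => f (h y)) (f' (h x) * dh).
Proof.
move=> fd h0 hd; have -> : (fun y => f (h y)) = fun y => extend_nonneg f f' (h y).
  by apply/funext => y; rewrite /extend_nonneg h0.
apply: is_derive_chain hd; exact: extend_nonneg_is_derive.
Qed.

End OneSidedDerivatives.

Section KaluzaKleinForm.
Variables (R : realType) (n : nat) (Q : 'M[R]_n.+1).
Hypothesis Qo : orthogonal_mx Q.
Variables (B C B1 C1 : R -> R).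
Hypotheses (Bd : derivative_on_nonneg B B1) (Cd : derivative_on_nonneg C C1).

Local Notation g := (sphere_metric Q).

Lemma bilin_sphere_metric u a b : bilin (g u) a b = conformal_factor u * dot a b.
Proof. by rewrite /bilin sphere_metricE // mul_mx_scalar -scalemxAl mxE. Qed.

(** The squared norm [|e|^2] of the tangent vector with coordinates [w], that is, the argument of
    the profile functions. *)
Definition energy_density (w : 'rV[R]_(n + n)) : R :=
  conformal_factor (lsubmx w) * dot (rsubmx w) (rsubmx w).

Lemma energy_density_ge0 w : 0 <= energy_density w.
Proof. by rewrite mulr_ge0 ?dot_ge0 // ltW // conformal_factor_gt0. Qed.

Lemma kk_formE A w a b : kk_form g A B C w a b =
  A (energy_density w) * (conformal_factor (lsubmx w) * dot (lsubmx a) (lsubmx b))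
  + B (energy_density w) * (conformal_factor (lsubmx w) *
      dot (rsubmx a + christoffel_form (lsubmx w) (lsubmx a) (rsubmx w))
          (rsubmx b + christoffel_form (lsubmx w) (lsubmx b) (rsubmx w)))
  + C (energy_density w) *
      (conformal_factor (lsubmx w) *
       dot (rsubmx a + christoffel_form (lsubmx w) (lsubmx a) (rsubmx w)) (rsubmx w)) *
      (conformal_factor (lsubmx w) *
       dot (rsubmx b + christoffel_form (lsubmx w) (lsubmx b) (rsubmx w)) (rsubmx w)).
Proof. by rewrite /kk_form !verticalE // !bilin_sphere_metric. Qed.

Variables (e : 'rV[R]_n).
Let w0 : 'rV[R]_(n + n) := row_mx 0 e.

(* The derivative of [christoffel_form u a e] at [u = 0] in the direction [d]. *)
Definition christoffel_diff (d a : 'rV[R]_n) : 'rV[R]_n :=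
  - 2 *: (dot d a *: e + dot d e *: a - dot a e *: d).

Lemma is_derive_lsubmx d j :
  is_derive w0 d (fun w : 'rV[R]_(n + n) => (lsubmx w) 0 j) ((lsubmx d) 0 j).
Proof. by under eq_fun do rewrite mxE; rewrite mxE; exact: is_derive_coord. Qed.

Lemma is_derive_rsubmx d j :
  is_derive w0 d (fun w : 'rV[R]_(n + n) => (rsubmx w) 0 j) ((rsubmx d) 0 j).
Proof. by under eq_fun do rewrite mxE; rewrite mxE; exact: is_derive_coord. Qed.

Lemma is_derive_inv_sqnorm1 d :
  is_derive w0 d (fun w => (1 + dot (lsubmx w) (lsubmx w))^-1) 0.
Proof.
have D0 : 1 + dot (lsubmx w0) (lsubmx w0) != 0 by rewrite sqnorm1_neq0.
have rd := is_derive_dot (is_derive_lsubmx d) (is_derive_lsubmx d).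
have Dd := is_derive_add (is_derive_cstE w0 d 1) rd.
apply: is_derive_eq (@is_derive_inv _ _ (fun w => 1 + dot (lsubmx w) (lsubmx w))
  _ _ _ D0 Dd) _.
by rewrite /w0 row_mxKl !(dot0l, dot0r) !addr0 oppr0 mul0r.
Qed.

Lemma is_derive_conformal_factor0 d :
  is_derive w0 d (fun w => conformal_factor (lsubmx w)) 0.
Proof.
have -> : (fun w : 'rV[R]_(n + n) => conformal_factor (lsubmx w)) =
    fun w => 4 * ((1 + dot (lsubmx w) (lsubmx w))^-1 * (1 + dot (lsubmx w) (lsubmx w))^-1).
  by apply/funext => w; rewrite /conformal_factor -expr2 exprVn.
have Vd := is_derive_inv_sqnorm1 d.
apply: is_derive_eq (is_derive_mul (is_derive_cstE w0 d 4) (is_derive_mul Vd Vd)) _.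
by rewrite !(mul0r, mulr0, addr0).
Qed.

Lemma conformal_factor0 : conformal_factor (0 : 'rV[R]_n) = 4.
Proof. by rewrite /conformal_factor dot0l addr0 expr1n divr1. Qed.

Lemma is_derive_energy_density d :
  is_derive w0 d energy_density (8 * dot e (rsubmx d)).
Proof.
have ed := is_derive_dot (is_derive_rsubmx d) (is_derive_rsubmx d).
apply: is_derive_eq (is_derive_mul (is_derive_conformal_factor0 d) ed) _.
by rewrite /w0 row_mxKl row_mxKr conformal_factor0 (dotC _ e); ring.
Qed.

Lemma is_derive_christoffel_form d a j :
  is_derive w0 d (fun w => christoffel_form (lsubmx w) a (rsubmx w) 0 j)
    (christoffel_diff (lsubmx d) a 0 j).
Proof.
have -> : (fun w : 'rV[R]_(n + n) => christoffel_form (lsubmx w) a (rsubmx w) 0 j) =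
    fun w => (- 2 * (1 + dot (lsubmx w) (lsubmx w))^-1) *
      (dot (lsubmx w) a * (rsubmx w) 0 j + dot (lsubmx w) (rsubmx w) * a 0 j
       - dot a (rsubmx w) * (lsubmx w) 0 j).
  by apply/funext => w; rewrite /christoffel_form !mxE mulNr.
have ld := is_derive_lsubmx d; have rd := is_derive_rsubmx d.
have ad i : is_derive w0 d (fun=> a 0 i) ((0 : 'rV[R]_n) 0 i).
  by rewrite mxE; apply: is_derive_cstE.
have d1 := is_derive_mul (is_derive_dot ld ad) (rd j).
have d2 := is_derive_mul (is_derive_dot ld rd) (is_derive_cstE w0 d (a 0 j)).
have d3 := is_derive_mul (is_derive_dot ad rd) (ld j).
have d4 := is_derive_mul (is_derive_cstE w0 d (-2)) (is_derive_inv_sqnorm1 d).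
apply: is_derive_eq (is_derive_mul d4 (is_derive_sub (is_derive_add d1 d2) d3)) _.
rewrite /w0 row_mxKl row_mxKr !(dot0l, dot0r) addr0 invr1 /christoffel_diff !mxE.
ring.
Qed.

(* The derivative of [kk_form w a b] at [w = row_mx 0 e] in the direction [d];
   the conformal factor is stationary there, with value 4. *)
Definition kk_diff (d a b : 'rV[R]_(n + n)) : R :=
  let t := 4 * dot e e in
  let a2 := rsubmx a in let b2 := rsubmx b in
  let La := christoffel_diff (lsubmx d) (lsubmx a) in
  let Lb := christoffel_diff (lsubmx d) (lsubmx b) in
  32 * B1 t * dot e (rsubmx d) * dot a2 b2 + 4 * B t * (dot La b2 + dot a2 Lb)
  + 128 * C1 t * dot e (rsubmx d) * dot a2 e * dot b2 e
  + 16 * C t * ((dot La e + dot a2 (rsubmx d)) * dot b2 e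
                + dot a2 e * (dot Lb e + dot b2 (rsubmx d))).

Lemma kk_form_is_derive (A : R -> R) d a b : (forall t, 0 <= t -> A t = 1) ->
  is_derive w0 d (fun w => kk_form g A B C w a b) (kk_diff d a b).
Proof.
move=> A1.
pose Y (c w : 'rV[R]_(n + n)) :=
  rsubmx c + christoffel_form (lsubmx w) (lsubmx c) (rsubmx w).
have Yd c j : is_derive w0 d (fun w => Y c w 0 j)
    (christoffel_diff (lsubmx d) (lsubmx c) 0 j).
  have -> : (fun w => Y c w 0 j) = fun w => (rsubmx c) 0 j +
      christoffel_form (lsubmx w) (lsubmx c) (rsubmx w) 0 j.
    by apply/funext => w; rewrite mxE.
  apply: is_derive_eq (is_derive_add (is_derive_cstE w0 d _)
    (is_derive_christoffel_form d (lsubmx c) j)) _.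
  by rewrite add0r.
have Y0 c : Y c w0 = rsubmx c.
  rewrite /Y /w0 row_mxKl row_mxKr /christoffel_form.
  by rewrite !(dot0l, scale0r, scaler0, subr0, addr0).
have -> : (fun w => kk_form g A B C w a b) = (fun w =>
    conformal_factor (lsubmx w) * dot (lsubmx a) (lsubmx b)
    + B (energy_density w) * (conformal_factor (lsubmx w) * dot (Y a w) (Y b w))
    + C (energy_density w) * (conformal_factor (lsubmx w) * dot (Y a w) (rsubmx w))
      * (conformal_factor (lsubmx w) * dot (Y b w) (rsubmx w))).
  by apply/funext => w; rewrite kk_formE A1 ?energy_density_ge0 // mul1r.
have fd := is_derive_conformal_factor0 d; have td := is_derive_energy_density d.
have t0 : energy_density w0 = 4 * dot e e.
  by rewrite /energy_density /w0 row_mxKl row_mxKr conformal_factor0.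
have Btd := is_derive_comp_nonneg Bd energy_density_ge0 td.
have Ctd := is_derive_comp_nonneg Cd energy_density_ge0 td.
have rd := is_derive_rsubmx d.
have d1 := is_derive_mul fd (is_derive_cstE w0 d (dot (lsubmx a) (lsubmx b))).
have d2 := is_derive_mul Btd (is_derive_mul fd (is_derive_dot (Yd a) (Yd b))).
have d3 := is_derive_mul Ctd (is_derive_mul fd (is_derive_dot (Yd a) rd)).
have d4 := is_derive_mul d3 (is_derive_mul fd (is_derive_dot (Yd b) rd)).
apply: is_derive_eq (is_derive_add (is_derive_add d1 d2) d4) _.
rewrite !Y0 t0 /w0 row_mxKl row_mxKr conformal_factor0 /kk_diff; ring.
Qed.

End KaluzaKleinForm.

Section LinearForms.
Variables (R : realType) (N : nat).

Definition linear_form (f : 'rV[R]_N -> R) : Prop :=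
  forall k x y, f (k *: x + y) = k * f x + f y.

Lemma linear_form_sum f x : linear_form f ->
  f x = \sum_i x 0 i * f (delta_mx 0 i).
Proof.
move=> fl; have f0 : f 0 = 0.
  by have := fl 1 0 0; rewrite scaler0 addr0 mul1r; lra.
rewrite {1}[x]row_sum_delta; elim/big_rec2: _ => [//|i a b _ <-].
by rewrite fl.
Qed.

Lemma bilinear_form_sum (f : 'rV[R]_N -> 'rV[R]_N -> R) x y :
  (forall z, linear_form (f^~ z)) -> (forall z, linear_form (f z)) ->
  f x y = \sum_i \sum_j x 0 i * y 0 j * f (delta_mx 0 i) (delta_mx 0 j).
Proof.
move=> fl fr; rewrite (linear_form_sum x (fl y)); apply: eq_bigr => i _.
rewrite (linear_form_sum y (fr _)) mulr_sumr.
by apply: eq_bigr => j _; rewrite mulrA.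
Qed.

End LinearForms.

(** * The vertical tension field *)

Section VerticalTension.
Variables (R : realType) (n : nat) (Q : 'M[R]_n.+1).
Hypothesis Qo : orthogonal_mx Q.
Variables (A B C B1 C1 : R -> R).
Hypotheses (A1 : forall t, 0 <= t -> A t = 1).
Hypotheses (Bd : derivative_on_nonneg B B1) (Cd : derivative_on_nonneg C C1).

Local Notation g := (sphere_metric Q).
Local Notation G := (kk_metric g A B C).

Hypothesis G_pos : forall w a, a != 0 -> 0 < bilin (G w) a a.

Lemma kk_form_linearl w b : linear_form (fun a => kk_form g A B C w a b).
Proof.
move=> k x y; rewrite !kk_formE //.
have E : rsubmx (k *: x + y) + christoffel_form (lsubmx w) (lsubmx (k *: x + y)) (rsubmx w) =
    k *: (rsubmx x + christoffel_form (lsubmx w) (lsubmx x) (rsubmx w))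
    + (rsubmx y + christoffel_form (lsubmx w) (lsubmx y) (rsubmx w)).
  rewrite /christoffel_form !linearP /= !(dotDl, dotZl, dotDr, dotZr).
  by apply/rowP => j; rewrite !mxE; ring.
rewrite E !linearP /= !(dotDl, dotZl); ring.
Qed.

Lemma kk_formC w a b : kk_form g A B C w a b = kk_form g A B C w b a.
Proof.
rewrite !kk_formE // (dotC (lsubmx a)).
rewrite (dotC (rsubmx a + _) (rsubmx b + _)); ring.
Qed.

Lemma kk_form_linearr w a : linear_form (kk_form g A B C w a).
Proof. by move=> k x y; rewrite !(kk_formC _ a) kk_form_linearl. Qed.

Lemma bilin_kk_metric w a b : bilin (G w) a b = kk_form g A B C w a b.
Proof.
rewrite (bilinear_form_sum a b (kk_form_linearl w) (kk_form_linearr w)).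
rewrite /bilin mxE exchange_big /=; apply: eq_bigr => j _.
rewrite [X in X * _ = _]mxE [b^T _ _]mxE mulr_suml; apply: eq_bigr => i _.
by rewrite mxE; ring.
Qed.

Variables (v : 'rV[R]_n -> 'rV[R]_n) (e : 'rV[R]_n) (M : 'M[R]_n) (p : 'I_n -> 'rV[R]_n).
Hypothesis v0 : v 0 = e.
Hypothesis v1 : forall i k, partial i (fun y => v y 0 k) 0 = M i k.
Hypothesis v2 : forall i k, partial i (partial i (fun y => v y 0 k)) 0 = p i 0 k.

Local Notation w0 := (row_mx 0 e).
Local Notation DG := (kk_diff B C B1 C1 e).

Lemma kk_diff_linear1 a b : linear_form (fun d => DG d a b).
Proof.
move=> k x y; rewrite /kk_diff /christoffel_diff !linearP /=.
rewrite !(dotDl, dotZl, dotDr, dotZr, dotNl, dotNr); ring.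
Qed.

Lemma kk_diff_linear2 d b : linear_form (fun a => DG d a b).
Proof.
move=> k x y; rewrite /kk_diff /christoffel_diff !linearP /=.
rewrite !(dotDl, dotZl, dotDr, dotZr, dotNl, dotNr); ring.
Qed.

Lemma kk_diffC d a b : DG d a b = DG d b a.
Proof.
rewrite /kk_diff (dotC (rsubmx b) (rsubmx a)).
rewrite (dotC (christoffel_diff e (lsubmx d) (lsubmx b)) (rsubmx a)).
rewrite (dotC (christoffel_diff e (lsubmx d) (lsubmx a)) (rsubmx b)); ring.
Qed.

Lemma kk_diff_linear3 d a : linear_form (DG d a).
Proof. by move=> k x y; rewrite !(kk_diffC d a) kk_diff_linear2. Qed.

Lemma partial_kk_metric i j l :
  partial i (fun y => G y j l) w0 = DG (delta_mx 0 i) (delta_mx 0 j) (delta_mx 0 l).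
Proof.
apply: partialE; under eq_fun do rewrite mxE.
exact: (kk_form_is_derive Qo Bd Cd).
Qed.

(* The [i]-th partial derivative at 0 of the section [u |-> (u, v u)]. *)
Definition section_diff i : 'rV[R]_(n + n) := row_mx (delta_mx 0 i) (row i M).

Let s y : 'rV[R]_(n + n) := row_mx y (v y).

Lemma partial_section i a : partial i (fun y => s y 0 a) 0 = section_diff i 0 a.
Proof.
rewrite /section_diff /s; case: (split_ordP a) => k ->.
  rewrite row_mxEl; under eq_fun do rewrite row_mxEl.
  exact: partialE (is_derive_coord _ _ _).
by rewrite row_mxEr mxE; under eq_fun do rewrite row_mxEr.
Qed.

Lemma partial2_section i a :
  partial i (partial i (fun y => s y 0 a)) 0 = (row_mx 0 (p i) : 'rV_(n + n)) 0 a.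
Proof.
rewrite /s; case: (split_ordP a) => k ->.
  rewrite row_mxEl mxE; under eq_fun do rewrite row_mxEl.
  have -> : partial i (fun y : 'rV[R]_n => y 0 k) = fun=> (delta_mx 0 i : 'rV[R]_n) 0 k.
    by apply/funext => y; exact: partialE (is_derive_coord _ _ _).
  exact: partialE (is_derive_cstE _ _ _).
by rewrite row_mxEr; under eq_fun do rewrite row_mxEr.
Qed.

Lemma kk_metric_unit : G w0 \in unitmx.
Proof.
rewrite -row_free_unit -kermx_eq0; apply/rowV0P => x /sub_kermxP xG.
by apply/eqP; apply: contraT => /(G_pos w0); rewrite /bilin xG mul0mx mxE ltxx.
Qed.

(* Four times the product of the tension field with the vertical vector [z]:
   lowering the index removes the inverse Gram matrix from the Christoffel
   symbols. *)
Definition first_variation (z : 'rV[R]_n) : R :=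
  \sum_i (kk_form g A B C w0 (row_mx 0 (p i)) (row_mx 0 z)
    + DG (section_diff i) (section_diff i) (row_mx 0 z)
    - 2^-1 * DG (row_mx 0 z) (section_diff i) (section_diff i)).

Lemma kk_metric_sym : (G w0)^T = G w0.
Proof. by apply/matrixP => i j; rewrite !mxE kk_formC. Qed.

(** Christoffel symbols of the first kind of the bundle metric, contracted twice with
    [section_diff i]; this contraction makes two of their three terms equal, which absorbs the
    factor [2^-1]. *)
Definition lowered_christoffel i : 'rV[R]_(n + n) :=
  \row_l (DG (section_diff i) (section_diff i) (delta_mx 0 l)
          - 2^-1 * DG (delta_mx 0 l) (section_diff i) (section_diff i)).

Lemma christoffel_kk_metric i c :
  \sum_a \sum_b christoffel G w0 c a b * section_diff i 0 a * section_diff i 0 b =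
  (lowered_christoffel i *m (invmx (G w0))^T) 0 c.
Proof.
rewrite mxE; set S := section_diff i; set H := invmx _.
pose K a b l := DG (delta_mx 0 a) (delta_mx 0 b) (delta_mx 0 l)
  + DG (delta_mx 0 b) (delta_mx 0 a) (delta_mx 0 l)
  - DG (delta_mx 0 l) (delta_mx 0 a) (delta_mx 0 b).
transitivity (\sum_l H c l * (2^-1 * \sum_a \sum_b S 0 a * S 0 b * K a b l)).
  under [RHS]eq_bigr do rewrite !mulr_sumr.
  rewrite [RHS]exchange_big /=; apply: eq_bigr => a _.
  under [RHS]eq_bigr do rewrite !mulr_sumr.
  rewrite [RHS]exchange_big /=; apply: eq_bigr => b _.
  rewrite /christoffel mulr_sumr !mulr_suml; apply: eq_bigr => l _.
  rewrite !partial_kk_metric /K -/H; ring.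
apply: eq_bigr => l _; rewrite !mxE mulrC; congr (_ * _).
have E1 := bilinear_form_sum S S (fun z => kk_diff_linear1 z (delta_mx 0 l))
  (fun z => kk_diff_linear2 z (delta_mx 0 l)).
have E2 := bilinear_form_sum S S (fun z => kk_diff_linear2 z (delta_mx 0 l))
  (fun z => kk_diff_linear1 z (delta_mx 0 l)).
have E3 := bilinear_form_sum S S (kk_diff_linear2 (delta_mx 0 l))
  (kk_diff_linear3 (delta_mx 0 l)).
rewrite -/S (_ : DG S S _ - _ = 2^-1 * (DG S S (delta_mx 0 l) + DG S S (delta_mx 0 l)
  - DG (delta_mx 0 l) S S)); last by field.
congr (_ * _); rewrite {1}E1 E2 E3 -big_split -sumrB /=; apply: eq_bigr => a _.
by rewrite -big_split -sumrB /=; apply: eq_bigr => b _; rewrite /K; ring.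
Qed.

(** At the centre the inverse metric of the sphere is [1/4] times the identity, whence the 4, and
    its Christoffel symbols vanish. Multiplication by the Gram matrix [G w0] cancels its inverse in
    the remaining ones. *)
Lemma tension_kk_metric b :
  kk_form g A B C w0 (4 *: tension g G s 0) b =
  \sum_i (kk_form g A B C w0 (row_mx 0 (p i)) b
    + DG (section_diff i) (section_diff i) b
    - 2^-1 * DG b (section_diff i) (section_diff i)).
Proof.
have TE : 4 *: tension g G s 0 =
    \sum_i (row_mx 0 (p i) + lowered_christoffel i *m (invmx (G w0))^T).
  apply/rowP => c; rewrite mxE summxE [in LHS]mxE mulr_sumr.
  apply: eq_bigr => i _; rewrite (bigD1 i) //= [X in 4 * (_ + X)]big1 => [|j ji].
    rewrite addr0 sphere_metricE // invmx_scalar conformal_factor0 mxE eqxx mulr1n.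
    rewrite mulrA divff // mul1r partial2_section [RHS]mxE; congr (_ + _).
      rewrite big1 ?subr0 // => k _.
      by rewrite christoffel_sphere // !mxE; ring.
    rewrite -christoffel_kk_metric /s v0.
    by apply: eq_bigr => a _; apply: eq_bigr => b' _; rewrite !partial_section.
  by rewrite sphere_metricE // invmx_scalar mxE eq_sym (negbTE ji) mul0r.
have hinv : (invmx (G w0))^T *m G w0 = 1%:M.
  by rewrite -{2}kk_metric_sym -trmx_mul mulmxV ?kk_metric_unit // trmx1.
rewrite -bilin_kk_metric TE /bilin !mulmx_suml summxE; apply: eq_bigr => i _.
rewrite !mulmxDl mxE -addrA; congr (_ + _); first by rewrite -bilin_kk_metric.
rewrite -[_ *m G w0]mulmxA hinv mulmx1.
rewrite mxE (linear_form_sum b (kk_diff_linear3 (section_diff i) (section_diff i))).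
rewrite (linear_form_sum b (kk_diff_linear1 (section_diff i) (section_diff i))).
rewrite mulr_sumr -sumrB; apply: eq_bigr => l _; rewrite !mxE; ring.
Qed.

(** Pairing with a vertical vector sees only the vertical part, by orthogonality to the horizontal
    space. Conversely [z] is taken to be the vertical part itself, and definiteness concludes. *)
Lemma vertical_tensionP :
  vertical_tension g A B C v 0 = 0 <-> forall z, first_variation z = 0.
Proof.
have fvE z : kk_form g A B C w0 (4 *: tension g G s 0) (row_mx 0 z) = first_variation z.
  by rewrite tension_kk_metric.
have vtE : vertical_tension g A B C v 0 = rsubmx (tension g G s 0).
  rewrite /vertical_tension verticalE // row_mxKl /christoffel_form.
  by rewrite !(dot0l, scale0r, scaler0, subr0, addr0).
have kkE a z : kk_form g A B C w0 a (row_mx 0 z) =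
    kk_form g A B C w0 (row_mx 0 (rsubmx a)) (row_mx 0 z).
  rewrite !kk_formE // !row_mxKl !row_mxKr /christoffel_form.
  by rewrite !(dot0l, dot0r, scale0r, scaler0, subr0, addr0, mulr0).
rewrite vtE; split=> [T0 z|fv0].
  rewrite -fvE kkE linearZ /= T0 scaler0 row_mx0 -bilin_kk_metric /bilin.
  by rewrite !mul0mx mxE.
have := fv0 (rsubmx (tension g G s 0)).
rewrite -fvE kkE linearZ /=; set r := rsubmx _.
have -> : row_mx 0 (4 *: r) = 4 *: row_mx 0 r + 0 :> 'rV[R]_(n + n).
  by rewrite addr0 scale_row_mx scaler0.
rewrite kk_form_linearl.
rewrite -[X in _ + X]bilin_kk_metric /bilin !mul0mx mxE addr0 -bilin_kk_metric => /eqP.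
rewrite mulf_eq0 pnatr_eq0 /= => /eqP K0; apply/eqP; apply: contraT => T0.
have /(G_pos w0) : row_mx 0 (rsubmx (tension g G s 0)) != 0 :> 'rV[R]_(n + n).
  by apply: contraNneq T0; rewrite -row_mx0 => /eq_row_mx[_ r0]; apply/eqP.
by rewrite K0 ltxx.
Qed.

End VerticalTension.

(** * The tension equation of a linear field in the chart *)

Section FirstVariation.
Variables (R : realType) (n : nat) (Q : 'M[R]_n.+1).
Hypothesis Qo : orthogonal_mx Q.
Variables (A B C B1 C1 : R -> R).
Variables (b : 'rV[R]_n) (M : 'M[R]_n).
Hypothesis Ms : skew M.

(** Value and repeated second partial derivatives at 0 of the quadratic field with data [b] and [M].
    As the conformal factor is 4 there, [b / 2] has metric norm [|b|]. *)
Let e := 2^-1 *: b.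
Let p i := - b + (2 * b 0 i) *: delta_mx 0 i.

Definition sqnorm_mx N (X : 'M[R]_N) : R := \sum_i dot (row i X) (row i X).

Lemma dot_row_skew (x : 'rV[R]_n) i : dot x (row i M) = - (x *m M) 0 i.
Proof. by rewrite rowE dotC skew_dot // dot_deltal. Qed.

Definition tension_form (z : 'rV[R]_n) : R :=
  let t := dot b b in
  ((n%:R - 1) * (B t + C t * t) + (B1 t - C t) * sqnorm_mx M
   - C1 t * dot (b *m M) (b *m M)) * dot b z
  + 2 * B1 t * dot (b *m M *m M) z.

Lemma first_variationE z :
  first_variation Q A B C B1 C1 e M p z = - 8 * tension_form z.
Proof.
have t0 : 4 * dot e e = dot b b by rewrite /e dotZl dotZr; field.
(* Each summand is written with products whose sum over [i] is a scalar product or [|M|^2]; skewness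
   turns [<b, row i M>] into [- (b M)_i]. *)
have fE i : kk_form (sphere_metric Q) A B C (row_mx 0 e) (row_mx 0 (p i)) (row_mx 0 z)
    + kk_diff B C B1 C1 e (section_diff M i) (section_diff M i) (row_mx 0 z)
    - 2^-1 * kk_diff B C B1 C1 e (row_mx 0 z) (section_diff M i) (section_diff M i) =
    (- 8 * (B (dot b b) + C (dot b b) * dot b b) * dot b z)
    + (8 * B (dot b b)) * (b 0 i * z 0 i) + (8 * C (dot b b) * dot b z) * (b 0 i * b 0 i)
    + (8 * (C (dot b b) - B1 (dot b b)) * dot b z) * dot (row i M) (row i M)
    + 16 * B1 (dot b b) * ((b *m M) 0 i * (z *m M) 0 i)
    + (8 * C1 (dot b b) * dot b z) * ((b *m M) 0 i * (b *m M) 0 i).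
  rewrite kk_formE // /energy_density /kk_diff /section_diff !row_mxKl !row_mxKr.
  rewrite conformal_factor0 t0 /christoffel_form /christoffel_diff.
  have ei : (2^-1 *: b) 0 i = 2^-1 * b 0 i by rewrite mxE.
  have dii : (delta_mx 0 i : 'rV[R]_n) 0 i = 1 by rewrite mxE !eqxx.
  set mm := dot (row i M) (row i M).
  rewrite !(dot0l, dot0r, scale0r, scaler0, subr0, addr0, mulr0, add0r).
  rewrite !dot_deltal dii scale1r (dotC (row i M) z) (dotC (row i M) e).
  rewrite /e /p !(dotDl, dotDr, dotZl, dotZr, dotNl, dotNr) !dot_row_skew.
  rewrite !dot_deltal !ei (dotC z b) !(dot0l, dot0r).
  by field.
rewrite /first_variation (eq_bigr _ (fun i _ => fE i)) !big_split /= -!mulr_sumr.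
rewrite sumr_const card_ord -!dotE -/(sqnorm_mx M) /tension_form.
rewrite (skew_dot (b *m M) z Ms).
rewrite -[dot b z *+ n]mulr_natr; ring.
Qed.

End FirstVariation.

Section QuadraticField.
Variables (R : realType) (n : nat) (b : 'rV[R]_n) (M : 'M[R]_n).

(** The chart expression found in [field_coordsE], with [b] for [field_center] and [M] for
    [field_rot]. *)
Definition quadratic_field (u : 'rV[R]_n) : 'rV[R]_n :=
  u *m M + ((1 - dot u u) / 2) *: b + dot u b *: u.

Lemma quadratic_field0 : quadratic_field 0 = 2^-1 *: b.
Proof.
by rewrite /quadratic_field !dot0l mul0mx scale0r addr0 add0r subr0 mul1r.
Qed.

Lemma quadratic_field_is_derive u i k :
  is_derive u (delta_mx 0 i) (fun y => quadratic_field y 0 k)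
    (M i k - u 0 i * b 0 k + b 0 i * u 0 k + dot u b * (i == k)%:R).
Proof.
set d : 'rV[R]_n := delta_mx 0 i.
have -> : (fun y => quadratic_field y 0 k) = fun y =>
    \sum_j y 0 j * M j k + ((1 - dot y y) * (2^-1 * b 0 k) + dot y b * y 0 k).
  apply/funext => y; rewrite /quadratic_field -addrA !mxE; congr (_ + _).
  by rewrite mulrA.
have cd j : is_derive u d (fun y : 'rV[R]_n => y 0 j) (d 0 j) by apply: is_derive_coord.
have bd j : is_derive u d (fun=> b 0 j) ((0 : 'rV[R]_n) 0 j).
  by rewrite mxE; apply: is_derive_cstE.
have d1 : is_derive u d (fun y : 'rV[R]_n => \sum_j y 0 j * M j k)
    (\sum_j (d 0 j * M j k + u 0 j * 0)).
  by apply: is_derive_bigsum => j; exact: is_derive_mul (cd j) (is_derive_cstE u d (M j k)).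
have d2 := is_derive_mul (is_derive_sub (is_derive_cstE u d 1) (is_derive_sqnorm u d))
  (is_derive_cstE u d (2^-1 * b 0 k)).
have d3 := is_derive_mul (is_derive_dot cd bd) (cd k).
apply: is_derive_eq (is_derive_add d1 (is_derive_add d2 d3)) _.
under eq_bigr do rewrite mulr0 addr0.
have -> : \sum_j d 0 j * M j k = M i k.
  by rewrite -[RHS](sum_delta (fun j => M j k)); apply: eq_bigr => j _; rewrite mxE eqxx.
have -> : d 0 k = (i == k)%:R by rewrite mxE eqxx eq_sym.
by rewrite dot0r dot_deltar dot_deltal; field.
Qed.

Lemma partial2_quadratic_field i k :
  partial i (partial i (fun y => quadratic_field y 0 k)) 0 =
  (- b + (2 * b 0 i) *: delta_mx 0 i) 0 k.
Proof.
have -> : partial i (fun y => quadratic_field y 0 k) =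
    fun u => M i k - u 0 i * b 0 k + b 0 i * u 0 k + dot u b * (i == k)%:R.
  by apply/funext => u; exact: partialE (quadratic_field_is_derive u i k).
set d : 'rV[R]_n := delta_mx 0 i.
have cd j : is_derive 0 d (fun y : 'rV[R]_n => y 0 j) (d 0 j) by apply: is_derive_coord.
have bd j : is_derive 0 d (fun=> b 0 j) ((0 : 'rV[R]_n) 0 j).
  by rewrite mxE; apply: is_derive_cstE.
have d1 := is_derive_mul (cd i) (is_derive_cstE 0 d (b 0 k)).
have d2 := is_derive_mul (is_derive_cstE 0 d (b 0 i)) (cd k).
have d3 := is_derive_mul (is_derive_dot cd bd) (is_derive_cstE 0 d ((i == k)%:R : R)).
have d4 := is_derive_add (is_derive_add (is_derive_sub (is_derive_cstE 0 d (M i k)) d1) d2) d3.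
apply: partialE; apply: is_derive_eq d4 _.
by rewrite !(dot0l, dot0r) dot_deltal !mxE !eqxx (eq_sym k i); case: (i == k) => /=; ring.
Qed.

End QuadraticField.

(** * The tension equation in ambient terms *)

Section HarmonicCriterion.
Variables (R : realType) (n : nat) (W : 'M[R]_n.+1).
Variables (xi : 'rV[R]_n.+1 -> 'rV[R]_n.+1).
Hypothesis Ws : skew W.
Hypothesis xiW : forall x, on_sphere x -> xi x = x *m W.
Variables (A B C B1 C1 : R -> R).
Hypotheses (A1 : forall t, 0 <= t -> A t = 1).
Hypotheses (Bd : derivative_on_nonneg B B1) (Cd : derivative_on_nonneg C C1).

(** The ambient form of [tension_form]. The corrections by t come from compressing [W] to the
    tangent space: [|M|^2 = |W|^2 - 2 t], [|b M|^2 = |a W|^2 - t^2], and [b M^2] corresponds to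
    [a W^2 + t a]. *)
Definition tension_at (x : 'rV[R]_n.+1) : 'rV[R]_n.+1 :=
  let a := x *m W in
  let t := dot a a in
  ((n%:R - 1) * (B t + C t * t) + (B1 t - C t) * (sqnorm_mx W - 2 * t)
   - C1 t * (dot (a *m W) (a *m W) - t ^+ 2)) *: a
  + (2 * B1 t) *: (a *m W *m W + t *: a).

Section InChart.
Variable Q : 'M[R]_n.+1.
Hypothesis Qo : orthogonal_mx Q.
Local Notation b := (field_center Q W).
Local Notation M := (field_rot Q W).
Local Notation x := (pole Q).

Lemma pole_field : x *m W = b *m axes Q.
Proof.
rewrite [LHS](pole_axes_decomp Qo) skew_dotxx // scale0r add0r.
by rewrite /field_center.
Qed.

Lemma axes_proj (y : 'rV[R]_n.+1) :
  y *m (axes Q)^T *m axes Q = y - dot y x *: x.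
Proof. by rewrite {2}[y](pole_axes_decomp Qo) addrC addKr. Qed.

Lemma field_rotE (y : 'rV[R]_n) : y *m M = y *m axes Q *m W *m (axes Q)^T.
Proof. by rewrite /field_rot !mulmxA. Qed.

Lemma field_center_rot :
  b *m M *m axes Q = x *m W *m W + dot (x *m W) (x *m W) *: x.
Proof.
rewrite field_rotE -pole_field axes_proj skew_dot //.
by rewrite scaleNr opprK.
Qed.

Lemma field_center_rot2 :
  b *m M *m M *m axes Q = x *m W *m W *m W + dot (x *m W) (x *m W) *: (x *m W).
Proof.
rewrite (field_rotE (b *m M)) field_center_rot axes_proj mulmxDl -scalemxAl.
rewrite dotDl dotZl (skew_dotxx x Ws) mulr0 addr0.
by rewrite (skew_dot _ x Ws) (skew_dotxx (x *m W) Ws) oppr0 scale0r subr0.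
Qed.

Lemma field_center_sqnorm : dot b b = dot (x *m W) (x *m W).
Proof. by rewrite pole_field dot_axes. Qed.

Lemma field_center_rot_sqnorm : dot (b *m M) (b *m M) =
  dot (x *m W *m W) (x *m W *m W) - dot (x *m W) (x *m W) ^+ 2.
Proof.
rewrite -(dot_axes Qo) field_center_rot !(dotDl, dotDr, dotZl, dotZr) dot_pole //.
by rewrite (dotC x) (skew_dot _ x Ws); ring.
Qed.

(** In the orthonormal basis formed by [x] and the axes, the row and the column of [x] each
    contribute [|x W|^2] to [|W|^2]. *)
Lemma sqnorm_field_rot : sqnorm_mx M = sqnorm_mx W - 2 * dot (x *m W) (x *m W).
Proof.
have trE N (X : 'M[R]_N) : sqnorm_mx X = \tr (X *m X^T).
  apply: eq_bigr => i _; rewrite mxE dotE; apply: eq_bigr => j _.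
  by rewrite !mxE.
have WE : sqnorm_mx W = dot (x *m W) (x *m W) +
    \sum_i dot (delta_mx 0 i *m axes Q *m W) (delta_mx 0 i *m axes Q *m W).
  rewrite trE; transitivity (\tr (Q *m W *m (Q *m W)^T)).
    by rewrite trmx_mul !mulmxA [RHS]mxtrace_mulC !mulmxA orthogonal_mxC // mul1mx.
  rewrite -trE /sqnorm_mx big_ord_recl !row_mul; congr (_ + _).
  by apply: eq_bigr => i _; rewrite row_mul -rowE rowK.
rewrite WE.
have rE i : dot (delta_mx 0 i *m axes Q *m W) (delta_mx 0 i *m axes Q *m W) =
    b 0 i * b 0 i + dot (row i M) (row i M).
  set y := _ *m W; rewrite {1 2}[y](pole_axes_decomp Qo).
  rewrite !(dotDl, dotDr, dotZl, dotZr) dot_pole // (dotC (_ *m axes Q) x).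
  rewrite !dot_pole_axes // dot_axes // !mulr0 addr0 add0r.
  have yx : dot y x = - b 0 i.
    by rewrite /y skew_dot // pole_field dot_axes // dot_deltal.
  rewrite mulr1 yx mulrNN; congr (_ + _).
  have -> // : y *m (axes Q)^T = row i M.
  by rewrite rowE field_rotE.
under eq_bigr do rewrite rE.
rewrite big_split /= -dotE pole_field dot_axes // /sqnorm_mx; ring.
Qed.

(** [first_variation z] is [-8] times the product of [tension_at x] with [z *m axes Q]. As
    [tension_at x] is orthogonal to [x], testing it against the axes loses nothing. *)
Lemma harmonic_at_pole :
  (forall w a, a != 0 -> 0 < bilin (kk_metric (sphere_metric Q) A B C w) a a) ->
  vertical_tension (sphere_metric Q) A B C (field_coords Q xi) 0 = 0
  <-> tension_at x = 0.
Proof.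
move=> Gpos.
have -> : field_coords Q xi = quadratic_field b M.
  by apply/funext => u; exact: field_coordsE.
have v1 i k : partial i (fun y => quadratic_field b M y 0 k) 0 = M i k.
  apply: partialE; apply: is_derive_eq (quadratic_field_is_derive b M 0 i k) _.
  by rewrite dot0l [X in X * b 0 k]mxE [X in b 0 i * X]mxE; ring.
have Ms := @field_rot_skew _ _ Q _ Ws.
have E z : tension_form B C B1 C1 b M z = dot (tension_at x) (z *m axes Q).
  rewrite /tension_form /tension_at sqnorm_field_rot dotDl !dotZl.
  rewrite field_center_rot_sqnorm -field_center_rot2 field_center_sqnorm.
  have -> : dot (x *m W) (z *m axes Q) = dot b z by rewrite pole_field dot_axes.
  by rewrite dot_axes.
have tx : dot (tension_at x) x = 0.
  rewrite /tension_at -field_center_rot2 dotDl !dotZl skew_dotxx //.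
  by rewrite (dotC _ x) dot_pole_axes // !mulr0 addr0.
apply: (iff_trans (vertical_tensionP Qo A1 Bd Cd Gpos (quadratic_field0 b M) v1
  (partial2_quadratic_field b M))).
split=> [fv0|T0 z]; last first.
  by rewrite (first_variationE Qo A B C B1 C1 b Ms) // E T0 dot0l mulr0.
rewrite [LHS](pole_axes_decomp Qo) tx scale0r add0r.
suff -> : tension_at x *m (axes Q)^T = 0 by rewrite mul0mx.
apply: dot_inj => z; rewrite dot_mulmx trmxK dot0l -E.
have := fv0 z; rewrite (first_variationE Qo A B C B1 C1 b Ms) // => /eqP.
by rewrite mulf_eq0 oppr_eq0 pnatr_eq0 /= => /eqP.
Qed.

End InChart.

Lemma harmonic_sectionP : kaluza_klein n A B C ->
  harmonic_section A B C xi <-> forall x, on_sphere x -> tension_at x = 0.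
Proof.
move=> [_ _ Gpos]; split=> [xi_harm x xx|T0 Q Qo].
  have [Q Qo Qx] := exists_orthogonal_row0 xx.
  by rewrite -Qx; apply/harmonic_at_pole => //; [exact: Gpos|exact: xi_harm].
by apply/harmonic_at_pole => //; [exact: Gpos|apply: T0; exact: dot_pole].
Qed.

End HarmonicCriterion.

(** * Profile functions and positivity *)

Section ProfileFunctions.
Variable R : realType.

Lemma derivative_on_nonneg_is_derive (f f' : R -> R) :
  (forall t : R, is_derive t (1 : R) f (f' t)) -> derivative_on_nonneg f f'.
Proof.
move=> fd t t0; have [fdt fE] := fd t.
have {fdt} : (fun h : R => h^-1 *: ((f \o shift t) (h *: (1 : R)) - f t)) @ 0^' --> f' t.
  by rewrite -fE; exact: fdt.
move=> /cvgrPdist_le fd0; apply/cvgrPdist_le => e e0.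
have := fd0 e e0; rewrite near_withinE => -[d /= d0 dP].
rewrite near_withinE; exists d => // s /= sd st _.
have := dP (s - t); rewrite /= sub0r normrN distrC => /(_ sd).
rewrite subr_eq0 => /(_ st); rewrite [(s - t) *: 1]mulr1 subrK.
by rewrite mulrC.
Qed.

Lemma continuous_on_nonneg (f : R -> R) (t : R) : {for t, continuous f} ->
  f s @[s --> within [set s | 0 <= s]%classic (nbhs t)] --> f t.
Proof. by move=> fc; apply: cvg_trans fc; apply: cvg_app; apply: cvg_within. Qed.

Lemma C2_on_nonneg_cst (c : R) : C2_on_nonneg (fun=> c).
Proof.
exists (fun=> 0), (fun=> 0); split=> [||t _].
- by apply: derivative_on_nonneg_is_derive => t; apply: is_derive_cstE.
- by apply: derivative_on_nonneg_is_derive => t; apply: is_derive_cstE.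
- by apply: continuous_on_nonneg; apply: cst_continuous.
Qed.

Lemma scaled_expR_is_derive (K c t : R) :
  is_derive t (1 : R) (fun s => K * expR (- (c * s))) (- c * K * expR (- (c * t))).
Proof.
have cd : is_derive t (1 : R) (fun s : R => - (c * s)) (- c).
  apply: is_derive_eq (is_derive_opp (is_derive_mul (is_derive_cstE t 1 c)
    (is_derive_id t (1 : R)))) _.
  by rewrite mul0r add0r mulr1.
have ed := @is_derive_chain _ _ (@expR R) (fun s : R => - (c * s)) t 1 _ _
  (is_derive_expR _) cd.
apply: is_derive_eq (is_derive_mul (is_derive_cstE t 1 K) ed) _.
by rewrite mul0r add0r; ring.
Qed.

Lemma C2_on_nonneg_scaled_expR (K c : R) :
  C2_on_nonneg (fun s => K * expR (- (c * s))).
Proof.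
exists (fun t => - c * K * expR (- (c * t))), (fun t => - c * (- c * K) * expR (- (c * t))).
split=> [||t _].
- by apply: derivative_on_nonneg_is_derive => t; apply: scaled_expR_is_derive.
- by apply: derivative_on_nonneg_is_derive => t; apply: scaled_expR_is_derive.
- apply: continuous_on_nonneg; apply: differentiable_continuous.
  by apply/derivable1_diffP; have [] := scaled_expR_is_derive (- c * (- c * K)) c t.
Qed.

Lemma derivative_on_nonneg_cst (f f' : R -> R) (a b : R) :
  derivative_on_nonneg f f' -> 0 <= a -> a < b ->
  (forall t, a < t < b -> f' t = 0) -> f a = f b.
Proof.
move=> fd a0 ab f'0; pose F := extend_nonneg f f'.
have Fd (t : R) : 0 <= t -> is_derive t (1 : R) F (f' t).
  exact: extend_nonneg_is_derive.
have [t||t tab] := @MVT R F f' a b ab.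
- by rewrite in_itv /= => /andP[at_ _]; apply: Fd; lra.
- apply: derivable_within_continuous => t; rewrite in_itv /= => /andP[at_ _].
  by have [] := Fd t (le_trans a0 at_).
have b0 : 0 <= b by lra.
rewrite /F /extend_nonneg a0 b0 f'0; last by rewrite in_itv /= in tab.
by rewrite mul0r => /eqP; rewrite subr_eq0 eq_sym => /eqP.
Qed.

End ProfileFunctions.

Section Positivity.
Variables (R : realType) (n : nat) (A B C : R -> R).

Lemma kk_metric_vertical (e z : 'rV[R]_n) (Q : 'M[R]_n.+1) : orthogonal_mx Q ->
  bilin (kk_metric (sphere_metric Q) A B C (row_mx 0 e)) (row_mx 0 z) (row_mx 0 z) =
  4 * B (4 * dot e e) * dot z z + 16 * C (4 * dot e e) * dot z e ^+ 2.
Proof.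
move=> Qo; rewrite bilin_kk_metric // kk_formE // /energy_density.
rewrite !row_mxKl !row_mxKr conformal_factor0 /christoffel_form.
by rewrite !(dot0l, dot0r, scale0r, scaler0, subr0, addr0, mulr0, add0r); ring.
Qed.

Hypothesis kk : kaluza_klein n A B C.

Lemma kaluza_klein_vertical (e z : 'rV[R]_n) : z != 0 ->
  0 < 4 * B (4 * dot e e) * dot z z + 16 * C (4 * dot e e) * dot z e ^+ 2.
Proof.
move=> z0; have [_ _ Gpos] := kk.
have Qo : orthogonal_mx (1%:M : 'M[R]_n.+1) by rewrite /orthogonal_mx trmx1 mulmx1.
rewrite -(kk_metric_vertical e z Qo); apply: Gpos => //.
by apply: contraNneq z0; rewrite -row_mx0 => /eq_row_mx[_ ->].
Qed.

Hypothesis n1 : (1 < n)%N.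

(** Definiteness is tested on vertical vectors at some [e] with [|e|^2 = t]: a vector orthogonal to
    [e], available as [n > 1], gives [B], and [e] itself gives [B + t C]. *)
Lemma kaluza_klein_pos t : 0 <= t -> 0 < B t /\ 0 < B t + C t * t.
Proof.
move=> t0; pose i0 : 'I_n := Ordinal (ltnW n1); pose i1 : 'I_n := Ordinal n1.
(* The conformal factor 4 at the centre accounts for the division by 2. *)
pose e : 'rV[R]_n := (Num.sqrt t / 2) *: delta_mx 0 i0.
have e00 : (delta_mx 0 i0 : 'rV[R]_n) 0 i0 = 1 by rewrite mxE !eqxx.
have ee : 4 * dot e e = t.
  rewrite dotZl dotZr dot_deltal e00 mulr1 -expr2 expr_div_n sqr_sqrtr //.
  by field.
have d1 : dot (delta_mx 0 i1) (delta_mx 0 i1 : 'rV[R]_n) = 1.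
  by rewrite dot_deltal mxE !eqxx.
have d1e : dot (delta_mx 0 i1) e = 0.
  by rewrite dotZr dot_deltal mxE (_ : (i1 == i0) = false) ?andbF ?mulr0.
have Bt : 0 < B t.
  have := @kaluza_klein_vertical e (delta_mx 0 i1).
  rewrite -dot_eq0 d1 oner_eq0 ee d1e expr0n /= !mulr0 addr0 mulr1 => /(_ isT); lra.
split=> //; case: (eqVneq t 0) => [tz|tn0]; first by rewrite [X in _ * X]tz mulr0 addr0.
have := @kaluza_klein_vertical e e; rewrite -dot_eq0 ee.
have -> : dot e e = t / 4 by rewrite -ee; field.
rewrite mulf_neq0 ?invr_neq0 // => /(_ isT).
have tp : 0 < t by rewrite lt_neqAle eq_sym tn0.
rewrite (_ : _ + _ = t * (B t + C t * t)); last by field.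
by rewrite pmulr_rgt0.
Qed.

End Positivity.

(** * Algebra of rotation fields *)

Section RotationFields.
Variables (R : realType) (n : nat).

Lemma rotation_field_sq m (y : 'rV[R]_n.+1) : (2 * m <= n.+1)%N ->
  rotation_field m (rotation_field m y) = \row_j (if (j < 2 * m)%N then - y 0 j else 0).
Proof.
move=> mn; apply/rowP => j; rewrite [LHS]mxE [RHS]mxE.
case: ifP => // jm; have jE := odd_double_half j; rewrite -mul2n in jE.
case: ifP => jo; rewrite jo in jE.
  rewrite mxE inordK; last by lia.
  have -> : (j.-1 < 2 * m)%N by lia.
  have -> : odd j.-1 = false by rewrite -jE add1n /= mul2n odd_double.
  have -> : j.-1.+1 = j by lia.
  by rewrite inord_val.
have j1 : (j.+1 < 2 * m)%N by lia.
rewrite mxE inordK; last by lia.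
by rewrite j1 /= jo inord_val.
Qed.

Variables (W : 'M[R]_n.+1) (m : nat) (lambda : R) (xi : 'rV[R]_n.+1 -> 'rV[R]_n.+1).
Hypothesis Ws : skew W.
Hypothesis xiW : forall x, on_sphere x -> xi x = x *m W.
Hypothesis mn : (2 * m <= n.+1)%N.
Hypothesis xi_rot : rotation_in_coords m lambda xi.

Lemma rotation_fieldZ c (y : 'rV[R]_n.+1) :
  rotation_field m (c *: y) = c *: rotation_field m y.
Proof.
apply/rowP => j; rewrite !mxE; case: ifP => _; rewrite ?mulr0 //.
by case: ifP; rewrite ?mulrN.
Qed.

(** Both sides are homogeneous, so the identity on the sphere extends to the whole space. *)
Lemma rotation_in_coords_linear : exists2 P, orthogonal_mx P &
  forall x : 'rV_n.+1, x *m W *m P^T = lambda *: rotation_field m (x *m P^T).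
Proof.
have [P [Po Prot]] := xi_rot; exists P => // x.
case: (eqVneq x 0) => [->|x0].
  have -> : rotation_field m (0 *m P^T) = 0.
    by rewrite mul0mx; have := rotation_fieldZ 0 0; rewrite !scale0r.
  by rewrite !mul0mx scaler0.
have [c c0 cx] := exists_unit_multiple x0.
have := Prot _ cx; rewrite xiW // -!scalemxAl rotation_fieldZ scalerA mulrC -scalerA.
by apply: scalerI; rewrite gt_eqF.
Qed.

Lemma rotation_cube : W *m W *m W = - lambda ^+ 2 *: W.
Proof.
have [P Po Prot] := rotation_in_coords_linear.
apply/row_matrixP => i; rewrite !rowE !mulmxA; set x := delta_mx 0 i.
have Pinj : injective (fun y : 'rV[R]_n.+1 => y *m P^T).
  by move=> y z /(congr1 (mulmx^~ P)); rewrite -!mulmxA orthogonal_mxC // !mulmx1.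
apply: Pinj => /=.
rewrite !Prot rotation_fieldZ -scalemxAr -scalemxAl Prot !rotation_fieldZ !scalerA.
rewrite rotation_field_sq //.
have -> : \row_j (if (j < 2 * m)%N then - (rotation_field m (x *m P^T)) 0 j else 0) =
    - rotation_field m (x *m P^T).
  by apply/rowP => j; rewrite !mxE; case: (j < 2 * m)%N; rewrite ?oppr0.
by rewrite scalerN -scaleNr; congr (_ *: _); ring.
Qed.

(** [|W|^2 = - tr W^2], and in the basis [P] the diagonal of [W^2] consists of [2 m] entries
    [- lambda^2] followed by zeros. *)
Lemma rotation_sqnorm : sqnorm_mx W = lambda ^+ 2 * (2 * m)%:R.
Proof.
have [P Po Prot] := rotation_in_coords_linear.
have -> : sqnorm_mx W = - \tr (P *m W *m W *m P^T).
  rewrite mxtrace_mulC !mulmxA orthogonal_mxC // mul1mx -raddfN -mulmxN -Ws.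
  apply: eq_bigr => i _; rewrite mxE dotE; apply: eq_bigr => j _.
  by rewrite !mxE.
have E i : (P *m W *m W *m P^T) i i = - lambda ^+ 2 * (i < 2 * m)%:R.
  transitivity ((row i P *m W *m W *m P^T) 0 i); first by rewrite -!row_mul [RHS]mxE.
  rewrite !Prot rotation_fieldZ scalerA rotation_field_sq // [LHS]mxE [X in _ * X]mxE -expr2.
  have -> : (row i P *m P^T) 0 i = 1 by rewrite -row_mul Po !mxE eqxx.
  by case: ifP => _; rewrite ?mulr0 ?mulr1 ?mulrN ?mulNr ?mulr1 // oppr0.
rewrite /mxtrace (eq_bigr _ (fun i _ => E i)) -mulr_sumr mulNr opprK; congr (_ * _).
rewrite -natr_sum; congr (_%:R).
transitivity (\sum_(i < n.+1 | (i < 2 * m)%N) 1)%N.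
  by rewrite [RHS]big_mkcond; apply: eq_bigr => i _; case: (i < 2 * m)%N.
by rewrite -(big_ord_widen _ (fun=> 1%N) mn) sum1_card card_ord.
Qed.

End RotationFields.

(** * Harmonicity forces a rotation with a single frequency *)

Section Necessity.
Variables (R : realType) (n : nat) (W : 'M[R]_n.+1) (B C B1 C1 : R -> R).
Hypothesis Ws : skew W.
Hypothesis n1 : (1 < n)%N.
Hypotheses (Bd : derivative_on_nonneg B B1) (Cd : derivative_on_nonneg C C1).
Hypothesis Bpos : forall t, 0 <= t -> 0 < B t /\ 0 < B t + C t * t.
Hypothesis tension0 : forall x, on_sphere x -> tension_at W B C B1 C1 x = 0.

Lemma dot_skew2 (x y : 'rV[R]_n.+1) : dot (x *m W *m W) y = dot x (y *m W *m W).
Proof. by rewrite !(skew_dot _ _ Ws) opprK. Qed.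

Section WithAxis.
Variable w : 'rV[R]_n.+1.
Hypotheses (ww : dot w w = 1) (wW : w *m W = 0).

(* Tilting a unit vector towards the axis [w] rescales the field, so its norm
   takes all small values without changing its direction. *)
Lemma exists_tilted_vector (x : 'rV[R]_n.+1) : x *m W != 0 ->
  exists2 t0 : R, 0 < t0 & forall t, 0 < t <= t0 ->
    exists y c, [/\ on_sphere y, y *m W = c *: (x *m W), c != 0 &
      c ^+ 2 * dot (x *m W) (x *m W) = t].
Proof.
move=> xW; set a := x *m W; have a0 : 0 < dot a a by rewrite dot_gt0.
pose x1 := x - dot x w *: w.
have x1W : x1 *m W = a by rewrite mulmxBl -scalemxAl wW scaler0 subr0.
have x1w : dot x1 w = 0 by rewrite dotDl dotNl dotZl ww mulr1 subrr.
have x10 : 0 < dot x1 x1.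
  by rewrite dot_gt0; apply: contraNneq xW => x10; rewrite -/a -x1W x10 mul0mx.
clearbody x1; exists (dot a a / dot x1 x1) => [|t /andP[t0 tle]]; first exact: divr_gt0.
pose c := Num.sqrt (t / dot a a).
have c2 : c ^+ 2 = t / dot a a by rewrite sqr_sqrtr // ltW // divr_gt0.
have cx : 0 <= 1 - c ^+ 2 * dot x1 x1.
  by rewrite subr_ge0 c2 mulrAC ler_pdivrMr // mul1r -ler_pdivlMr.
pose d := Num.sqrt (1 - c ^+ 2 * dot x1 x1).
have d2 : d ^+ 2 = 1 - c ^+ 2 * dot x1 x1 by rewrite sqr_sqrtr.
exists (c *: x1 + d *: w), c; split.
- rewrite /on_sphere !(dotDl, dotDr, dotZl, dotZr) (dotC w) x1w ww.
  by rewrite !mulr0 addr0 add0r mulr1 -expr2 d2 mulrA -expr2; ring.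
- by rewrite mulmxDl -!scalemxAl wW scaler0 addr0 x1W.
- by rewrite gt_eqF // sqrtr_gt0 divr_gt0.
- by rewrite c2 divfK // gt_eqF.
Qed.

(** Rayleigh quotient of [W W^T = - W^2] at [a]. *)
Definition ratio (a : 'rV[R]_n.+1) : R := dot (a *m W) (a *m W) / dot a a.

Lemma small_tension (x : 'rV[R]_n.+1) : x *m W != 0 ->
  exists2 t0 : R, 0 < t0 & forall t, 0 < t <= t0 -> let a := x *m W in
    ((n%:R - 1) * (B t + C t * t) + (B1 t - C t) * (sqnorm_mx W - 2 * t)
      - C1 t * (t * ratio a - t ^+ 2)) *: a
    + (2 * B1 t) *: (a *m W *m W + t *: a) = 0.
Proof.
move=> xW; have [t0 t00 ex] := exists_tilted_vector xW; exists t0 => // t tt.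
have [y [c [yS yW c0 ct]]] := ex t tt.
have := tension0 yS; rewrite /tension_at yW dotZl dotZr mulrA -expr2 ct.
have -> : dot (c *: (x *m W) *m W) (c *: (x *m W) *m W) = t * ratio (x *m W).
  rewrite -!scalemxAl dotZl dotZr mulrA -expr2 /ratio -ct; field.
  by rewrite dot_eq0.
rewrite -!scalemxAl => E; apply: (scalerI c0); rewrite scaler0 -[RHS]E.
by rewrite scalerDr !scalerA; congr (_ *: _ + _); [ring|
  rewrite !scalerDr !scalerA; congr (_ *: _ + _ *: _); ring].
Qed.

Lemma not_eigen_B1 (x : 'rV[R]_n.+1) : (forall nu, x *m W *m W *m W != nu *: (x *m W)) ->
  exists2 t0 : R, 0 < t0 & forall t, 0 < t <= t0 -> B1 t = 0.
Proof.
move=> xeig; have xW : x *m W != 0.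
  by apply: contraNneq (xeig 0) => ->; rewrite !mul0mx scaler0.
have [t0 t00 E] := small_tension xW; exists t0 => // t tt.
have := E t tt; rewrite /=; set k := _ - _; set a := x *m W.
apply: contra_eq => B10; rewrite scalerDr scalerA [_ + (_ *: a)]addrC addrA -scalerDl.
set k' := k + _; rewrite addr_eq0 eq_sym eqr_oppLR.
apply: contraNneq (xeig (- (k' / (2 * B1 t)))) => H.
have B20 : 2 * B1 t != 0 by rewrite mulf_neq0.
by rewrite -/a -[a *m W *m W](scalerK B20) H scalerN scalerA scaleNr (mulrC _^-1).
Qed.

Lemma ratio_eigen (x : 'rV[R]_n.+1) nu : x *m W != 0 -> x *m W *m W *m W = nu *: (x *m W) ->
  ratio (x *m W) = - nu.
Proof.
move=> xW xeig; rewrite /ratio skew_dot // xeig dotZr mulNr mulfK // dot_eq0 //.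
Qed.

(** Polarising [|a W|^2 = mu |a|^2] over the image of [W] gives [W^4 = - mu W^2], and one factor [W]
    cancels because [W^2] and [W] have the same kernel. *)
Lemma constant_ratio : (forall x y : 'rV[R]_n.+1, x *m W != 0 -> y *m W != 0 ->
    ratio (x *m W) = ratio (y *m W)) ->
  exists mu, W *m W *m W = mu *: W.
Proof.
move=> ratio_cst.
have [mu muP] : exists mu, forall x : 'rV_n.+1,
    dot (x *m W *m W) (x *m W *m W) = mu * dot (x *m W) (x *m W).
  have [[x0 x0W]|nx] := pselect (exists x : 'rV_n.+1, x *m W != 0); last first.
    exists 0 => x; have -> : x *m W = 0.
      by apply/eqP; apply: contraT => xW; case: nx; exists x.
    by rewrite mul0mx dot0l mul0r.
  exists (ratio (x0 *m W)) => x; case: (eqVneq (x *m W) 0) => [->|xW].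
    by rewrite mul0mx !dot0l mulr0.
  by rewrite (ratio_cst x0 x) // divfK // dot_eq0.
exists (- mu); apply/row_matrixP => i; rewrite !rowE -scalemxAr !mulmxA.
set x := delta_mx 0 i.
have polar y : dot (x *m W *m W) (y *m W *m W) = mu * dot (x *m W) (y *m W).
  have := muP (x + y); rewrite !mulmxDl !dotDl !dotDr !muP.
  rewrite (dotC (y *m W *m W)) (dotC (y *m W) (x *m W)); lra.
have zWW : (x *m W *m W + mu *: x) *m W *m W = 0.
  apply: dot_inj => y; rewrite dot0l !mulmxDl -!scalemxAl dotDl dotZl.
  rewrite dot_skew2 polar [dot (x *m W *m W) y]skew_dot //; ring.
have := skew_sq_eq0 Ws zWW; rewrite mulmxDl -scalemxAl => /eqP.
by rewrite addr_eq0 scaleNr => /eqP.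
Qed.

(** Were every vector of the image an eigenvector of [W^2], so would be [a1], [a2] and [a1 + a2].
    Distinct eigenvalues make [a1] and [a2] orthogonal, and pairing with each shows both eigenvalues
    equal to that of the sum. *)
Lemma distinct_ratios_not_eigen (x1 x2 : 'rV[R]_n.+1) : x1 *m W != 0 -> x2 *m W != 0 ->
  ratio (x1 *m W) != ratio (x2 *m W) ->
  exists x : 'rV[R]_n.+1, forall nu, x *m W *m W *m W != nu *: (x *m W).
Proof.
move=> x1W x2W r12; apply: contrapT => /forallNP noteig.
have eig (x : 'rV[R]_n.+1) : exists nu, x *m W *m W *m W = nu *: (x *m W).
  apply: contrapT => /forallNP xeig; apply: (noteig x) => nu.
  by apply/eqP/xeig.
have [nu1 E1] := eig x1; have [nu2 E2] := eig x2; have [nu E] := eig (x1 + x2).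
move: r12; rewrite (ratio_eigen x1W E1) (ratio_eigen x2W E2) eqr_opp => /negP[].
set a1 := x1 *m W in x1W E1 *; set a2 := x2 *m W in x2W E2 *.
have orth : (nu1 - nu2) * dot a1 a2 = 0.
  by rewrite mulrBl -dotZl -E1 -dotZr -E2 dot_skew2 subrr.
have {}E : nu1 *: a1 + nu2 *: a2 = nu *: (a1 + a2).
  by move: E; rewrite !mulmxDl -/a1 -/a2 E1 E2.
have e1 := congr1 (dot a1) E; have e2 := congr1 (dot a2) E.
have p1 : dot a1 a1 != 0 by rewrite dot_eq0.
have p2 : dot a2 a2 != 0 by rewrite dot_eq0.
move: e1 e2; rewrite !(dotDr, dotZr) (dotC a2 a1) => e1 e2.
case: (eqVneq nu1 nu2) => // n12.
have a12 : dot a1 a2 = 0 by apply/eqP; move/eqP: orth; rewrite mulf_eq0 subr_eq0 (negbTE n12).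
rewrite a12 !mulr0 ?addr0 ?add0r in e1 e2.
by case/eqP: n12; rewrite (mulIf p1 e1) (mulIf p2 e2).
Qed.

Lemma harmonic_cube : exists mu, W *m W *m W = mu *: W.
Proof.
apply: contrapT => ncube.
have [x1 [x2 [x1W x2W r12]]] : exists x1 x2 : 'rV[R]_n.+1, [/\ x1 *m W != 0, x2 *m W != 0 &
    ratio (x1 *m W) != ratio (x2 *m W)].
  apply: contrapT => nx; apply: ncube; apply: constant_ratio => x y xW yW.
  by apply/eqP; apply: contraT => xy; case: nx; exists x, y.
have [x xeig] := distinct_ratios_not_eigen x1W x2W r12.
have [t0 t00 B10] := not_eigen_B1 xeig.
have [t1 t10 E1] := small_tension x1W; have [t2 t20 E2] := small_tension x2W.
(* Below [s] the equation holds for the non-eigenvector and for both directions of distinct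
   ratio. *)
pose s := Num.min t0 (Num.min t1 t2).
have s0 : 0 < s by rewrite !lt_min t00 t10.
have key t : 0 < t <= s ->
    C1 t = 0 /\ (n%:R - 1) * (B t + C t * t) - C t * (sqnorm_mx W - 2 * t) = 0.
  move=> /andP[tp]; rewrite !le_min => /and3P[tt0 tt1 tt2].
  have := E1 t; have := E2 t; rewrite tp tt1 tt2 B10 ?tp // => /(_ isT) e2 /(_ isT) e1.
  move: e1 e2; rewrite /= mulr0 !scale0r !addr0 => /eqP + /eqP.
  rewrite !scaler_eq0 (negbTE x1W) (negbTE x2W) !orbF => /eqP e1 /eqP e2.
  have C10 : C1 t = 0.
    apply/eqP; have : C1 t * (t * (ratio (x1 *m W) - ratio (x2 *m W))) = 0 by lra.
    by move/eqP; rewrite !mulf_eq0 subr_eq0 (negbTE r12) orbF (gt_eqF tp) orbF.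
  by split=> //; move: e1; rewrite C10; lra.
have s2 : 0 < s / 2 by rewrite divr_gt0.
have ss : s / 2 < s by lra.
have Bs : B (s / 2) = B s.
  apply: (derivative_on_nonneg_cst Bd) => //; first exact: ltW.
  move=> t /andP[ts1 ts2]; apply: B10; rewrite (lt_trans s2) //=.
  by have := ltW ts2; rewrite !le_min => /and3P[].
have Cs : C (s / 2) = C s.
  apply: (derivative_on_nonneg_cst Cd) => //; first exact: ltW.
  by move=> t /andP[ts1 ts2]; apply: (key t _).1; rewrite (lt_trans s2) //= ltW.
have [_ k1] := key s ltac:(by rewrite s0 lexx).
have [_ k2] := key (s / 2) ltac:(by rewrite s2 ltW).
rewrite Bs Cs in k2.
have n0 : 0 < n%:R + 1 :> R by rewrite ltr_wpDl.
(* [B] and [C] agree at [s] and [s / 2], so subtracting the two equations leaves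
   [(n + 1) (s / 2) C s = 0]. *)
have C0 : C s = 0.
  have : (n%:R + 1) * (s * C s) = 0 by lra.
  by move/eqP; rewrite mulf_eq0 (gt_eqF n0) mulf_eq0 (gt_eqF s0) => /eqP.
have [Bp _] := Bpos (ltW s0).
have n10 : 0 < n%:R - 1 :> R by rewrite subr_gt0 ltr1n.
have : 0 < (n%:R - 1) * B s by rewrite mulr_gt0.
by move: k1; rewrite C0; lra.
Qed.

End WithAxis.

(** [mu |x W|^2 = <x W^3, x W> = - |x W^2|^2], with both norms non-zero for a suitable [x]. *)
Lemma skew_cube_neg mu : W != 0 -> W *m W *m W = mu *: W -> mu < 0.
Proof.
move=> W0 W3.
have [x xW] : exists x : 'rV_n.+1, x *m W != 0.
  apply: contrapT => nx; move/negP: W0; apply; apply/eqP/row_matrixP => i.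
  rewrite rowE row0; apply/eqP; apply: contraT => iW; case: nx.
  by exists (delta_mx 0 i).
have xWW : x *m W *m W != 0 by apply: contraNneq xW => /(skew_sq_eq0 Ws) ->.
have : dot (x *m W *m W *m W) (x *m W) = mu * dot (x *m W) (x *m W).
  by rewrite -!mulmxA (mulmxA W W) W3 -scalemxAr dotZl.
rewrite skew_dot //; have := dot_gt0 (x *m W *m W); rewrite xWW => p1.
have := dot_gt0 (x *m W); rewrite xW => p2 E.
rewrite ltNge; apply/negP => mu0.
by have := mulr_ge0 mu0 (ltW p2); rewrite -E oppr_ge0 leNgt p1.
Qed.

(** For a single frequency, rank 2 amounts to [|W|^2 = 2 lambda^2]. At a unit [x] in the image,
    [t = lambda^2] and [|a W|^2 = t^2], so the coefficients of [B' - C] and [C'] vanish, as does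
    [a W^2 + t a]. *)
Lemma harmonic_not_rank2 lambda : W != 0 -> W *m W *m W = - lambda ^+ 2 *: W ->
  sqnorm_mx W != lambda ^+ 2 * 2.
Proof.
move=> W0 W3; apply/negP => /eqP W2.
have [i iW] : exists i, row i W != 0.
  apply: contrapT => nx; move/negP: W0; apply; apply/eqP/row_matrixP => i.
  by rewrite row0; apply/eqP; apply: contraT => iW; case: nx; exists i.
have [c c0 xx] := exists_unit_multiple iW; set x := c *: row i W in xx.
have xWW : x *m W *m W = - lambda ^+ 2 *: x.
  rewrite /x rowE -!scalemxAl -!mulmxA (mulmxA W W) W3 -scalemxAr !scalerA.
  by rewrite mulrC.
have xW : dot (x *m W) (x *m W) = lambda ^+ 2.
  by rewrite skew_dot // xWW dotZr xx; ring.
have aWW : x *m W *m W *m W = - lambda ^+ 2 *: (x *m W) by rewrite xWW -scalemxAl.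
have := tension0 xx; rewrite /tension_at xW aWW xWW dotZl dotZr xx W2.
rewrite scaleNr addNr scaler0 addr0 => /eqP; rewrite scaler_eq0 => /orP[/eqP E|].
  have [_ Bp] := Bpos (sqr_ge0 lambda).
  have n10 : 0 < n%:R - 1 :> R by rewrite subr_gt0 ltr1n.
  by have := mulr_gt0 n10 Bp; move: E; lra.
move=> /eqP xW0; have : x *m W *m W = 0 by rewrite xW0 mul0mx.
rewrite xWW => /eqP; rewrite scaler_eq0 -(dot_eq0 x) xx oner_eq0 orbF oppr_eq0.
have := skew_cube_neg W0 W3; rewrite oppr_lt0 => p.
by rewrite gt_eqF.
Qed.

End Necessity.

(** * Rotations with a single frequency are harmonic *)

Section Sufficiency.
Variables (R : realType) (n : nat).

Lemma kaluza_klein_A1_C0 (B : R -> R) : C2_on_nonneg B -> (forall t, 0 < B t) ->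
  kaluza_klein n (fun=> 1) B (fun=> 0).
Proof.
move=> B2 B0; split=> [|t _|Q Qo w a a0]; rewrite ?ltr01 //.
  by split=> //; apply: C2_on_nonneg_cst.
rewrite bilin_kk_metric // kk_formE // mul1r !mul0r addr0.
have c0 := conformal_factor_gt0 (lsubmx w).
case: (eqVneq (lsubmx a) 0) => [a10|a10].
  rewrite a10 /christoffel_form.
  rewrite !(dot0l, dot0r, scale0r, scaler0, subr0, oppr0, addr0, mulr0, add0r).
  rewrite mulr_gt0 // mulr_gt0 // dot_gt0; apply: contraNneq a0 => a20.
  by rewrite -[a]hsubmxK a10 a20 row_mx0.
apply: ltr_pwDl; first by rewrite mulr_gt0 // dot_gt0.
by rewrite mulr_ge0 ?(ltW (B0 _)) // mulr_ge0 ?dot_ge0 // ltW.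
Qed.

(** For [C = 0] the terms [- 2 t B'] and [2 t B'] cancel, leaving
    [(n - 1) B + (2 m - 2) lambda^2 B' = 0]; the condition on [c] says that [B' = - c B] solves
    it. *)
Lemma rotation_harmonic (xi : 'rV[R]_n.+1 -> 'rV[R]_n.+1) (W : 'M[R]_n.+1) m lambda c K :
  skew W -> (forall x, on_sphere x -> xi x = x *m W) -> (2 * m <= n.+1)%N ->
  rotation_in_coords m lambda xi -> 0 < K ->
  c * (lambda ^+ 2 * (2 * m%:R - 2)) = n%:R - 1 ->
  let B t := K * expR (- (c * t)) in
  kaluza_klein n (fun=> 1) B (fun=> 0) /\ harmonic_section (fun=> 1) B (fun=> 0) xi.
Proof.
move=> Ws xiW mn xi_rot K0 cE B.
have kk : kaluza_klein n (fun=> 1) B (fun=> 0).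
  apply: kaluza_klein_A1_C0 => [|t]; first exact: C2_on_nonneg_scaled_expR.
  by rewrite mulr_gt0 // expR_gt0.
split=> //.
have Bd : derivative_on_nonneg B (fun t => - c * K * expR (- (c * t))).
  by apply: derivative_on_nonneg_is_derive => t; apply: scaled_expR_is_derive.
have Cd : derivative_on_nonneg (fun=> 0 : R) (fun=> 0).
  by apply: derivative_on_nonneg_is_derive => t; apply: is_derive_cstE.
apply/(harmonic_sectionP Ws xiW _ Bd Cd kk) => // x xx.
have W3 := rotation_cube xiW mn xi_rot.
have W2 := rotation_sqnorm Ws xiW mn xi_rot.
rewrite /tension_at W2.
have -> : x *m W *m W *m W = - lambda ^+ 2 *: (x *m W).
  by rewrite -!mulmxA (mulmxA W W) W3 -scalemxAr.
rewrite -scalerDl scalerA -scalerDl natrM; set t := dot _ _; set E := expR _.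
have -> : B t = K * E by [].
apply/eqP; rewrite scaler_eq0; apply/orP; left; apply/eqP.
by rewrite -cE; ring.
Qed.

End Sufficiency.

(** The great-circle argument starts from two orthonormal vectors and is therefore stated in [n.+2]
    coordinates; here the ambient dimension is brought to that shape. *)
Lemma killing_matrix (R : realType) n (xi : 'rV[R]_n.+1 -> 'rV[R]_n.+1) :
  (0 < n)%N -> killing xi ->
  exists2 W, skew W & forall x, on_sphere x -> xi x = x *m W.
Proof. by case: n xi => // n xi _; apply: killing_linear. Qed.

Lemma exists_unit_ker (R : realType) N (W : 'M[R]_N) : (\rank W < N)%N ->
  exists2 w : 'rV_N, dot w w = 1 & w *m W = 0.
Proof.
move=> rW; have /rowV0Pn[w /sub_kermxP wW w0] : kermx W != 0.
  by rewrite -mxrank_eq0 mxrank_ker subn_eq0 -ltnNge.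
have [c _ cw] := exists_unit_multiple w0.
by exists (c *: w) => //; rewrite -scalemxAl wW scaler0.
Qed.

Lemma harmonic_rotation (R : realType) n (xi : 'rV[R]_n.+1 -> 'rV[R]_n.+1)
    (W : 'M[R]_n.+1) (A B C : R -> R) m :
  skew W -> (forall x, on_sphere x -> xi x = x *m W) -> W != 0 -> (1 < n)%N ->
  \rank W = (2 * m)%N -> (2 * m < n.+1)%N ->
  kaluza_klein n A B C -> (forall t, 0 <= t -> A t = 1) -> harmonic_section A B C xi ->
  m <> 1%N /\ exists lambda, lambda <> 0 /\ rotation_in_coords m lambda xi.
Proof.
move=> Ws xiW W0 n1 rW mn kk A1 xi_harm.
have [[_ [B1 [B2 [Bd _ _]]] [C1 [C2 [Cd _ _]]]] _ _] := kk.
have tension0 := (harmonic_sectionP Ws xiW A1 Bd Cd kk).1 xi_harm.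
have [|w ww wW] := @exists_unit_ker _ _ W; first by rewrite rW.
have [mu W3] := harmonic_cube Ws n1 Bd Cd (kaluza_klein_pos kk n1) tension0 ww wW.
have mu0 := skew_cube_neg Ws W0 W3.
pose lambda := Num.sqrt (- mu).
have l0 : lambda != 0 by rewrite gt_eqF // sqrtr_gt0 oppr_gt0.
have {}W3 : W *m W *m W = - lambda ^+ 2 *: W.
  by rewrite W3 sqr_sqrtr ?opprK // oppr_ge0 ltW.
have [P Po PE] := skew_normal_form Ws l0 W3 rW.
have rot : rotation_in_coords m lambda xi by exists P; split=> // x xx; rewrite xiW.
split; last by exists lambda; split=> //; apply/eqP.
move=> m1; have := harmonic_not_rank2 Ws n1 (kaluza_klein_pos kk n1) tension0 W0 W3.
by rewrite (rotation_sqnorm Ws xiW (ltnW mn) rot) m1 eqxx.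
Qed.

Theorem proposition6p3 (R : realType) (p : nat) (hp : (1 <= p)%N)
    (xi : 'rV[R]_(2 * p).+1 -> 'rV[R]_(2 * p).+1)
    (xi_killing : killing xi)
    (xi_neq0 : exists x, on_sphere x /\ xi x <> 0) :
  exists k : nat,
    [/\ (k <= p - 1)%N,
        has_dim (invariant_axis xi) (2 * k + 1),
        (exists A B C : R -> R,
           [/\ kaluza_klein (2 * p) A B C,
               forall t : R, 0 <= t -> A t = 1 &
               harmonic_section A B C xi])
        <-> (k <> (p - 1)%N /\
             exists lambda : R,
               lambda <> 0 /\ rotation_in_coords (p - k) lambda xi) &
        k <> (p - 1)%N ->
        forall lambda : R, lambda <> 0 ->
          rotation_in_coords (p - k) lambda xi ->
          forall K : R, 0 < K ->
            let B := fun t : R =>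
              K * expR (- ((2 * p%:R - 1) * t
                           / (2 * lambda ^+ 2 * (p%:R - 1 - k%:R)))) in
            kaluza_klein (2 * p) (fun=> 1) B (fun=> 0) /\
            harmonic_section (fun=> 1) B (fun=> 0) xi].
Proof.
have [|W Ws xiW] := killing_matrix _ xi_killing; first lia.
have W0 : W != 0.
  have [x [xx xi0]] := xi_neq0; apply: contra_notN xi0 => /eqP W0.
  by rewrite xiW // W0 mulmx0.
(* [m] counts the rotation planes. The witness for [k] will be [p - m], since the axis has dimension
   [2 p + 1 - 2 m]. *)
have [m rW] : exists m, \rank W = (2 * m)%N.
  exists (\rank W)./2.
  exact: etrans (esym (even_halfK (skew_rank_even Ws))) (esym (mul2n _)).
have m0 : (0 < m)%N.
  by move: W0; rewrite -mxrank_eq0 rW muln_eq0 /= lt0n.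
have mp : (m <= p)%N.
  by have := rank_leq_row W; rewrite rW; lia.
have pk : (p - (p - m) = m)%N by lia.
have suff_dir : (p - m)%N <> (p - 1)%N -> forall lambda : R, lambda <> 0 ->
    rotation_in_coords m lambda xi -> forall K : R, 0 < K ->
    let B := fun t : R => K * expR (- ((2 * p%:R - 1) * t
      / (2 * lambda ^+ 2 * (p%:R - 1 - (p - m)%:R)))) in
    kaluza_klein (2 * p) (fun=> 1) B (fun=> 0) /\
    harmonic_section (fun=> 1) B (fun=> 0) xi.
  move=> m1 lambda /eqP l0 rot K K0 /=.
  pose c : R := (2 * p%:R - 1) / (2 * lambda ^+ 2 * (p%:R - 1 - (p - m)%:R)).
  have -> : (fun t : R => K * expR (- ((2 * p%:R - 1) * t
      / (2 * lambda ^+ 2 * (p%:R - 1 - (p - m)%:R))))) = fun t => K * expR (- (c * t)).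
    by apply/funext => t; rewrite mulrAC.
  (* [m - 1] is the factor [p - 1 - k] in the denominator of [c]; it is zero only in the excluded
     case of a maximal axis. *)
  have m10 : m%:R - 1 != 0 :> R.
    by rewrite subr_eq0 pnatr_eq1; apply/eqP; lia.
  apply: (rotation_harmonic Ws xiW _ rot K0); first lia.
  rewrite /c natrB // natrM; field.
  by rewrite l0 andbT (_ : _ - _ = m%:R - 1) //; ring.
exists (p - m)%N; rewrite pk; split=> //; first lia.
  have [U [UW dimU]] := has_dim_ker W; exists U; split=> [w|].
    by rewrite UW /=; split=> /(invariant_axisE Ws xiW).
  by rewrite dimU rW; lia.
split=> [[A [B [C [kk A1 xi_harm]]]]|[m1 [lambda [l0 rot]]]].
  have [||m1 rot] := harmonic_rotation Ws xiW W0 _ rW _ kk A1 xi_harm; try lia.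
  by split=> //; lia.
have [kk xi_harm] := suff_dir m1 lambda l0 rot 1 ltr01.
by exists (fun=> 1); eexists; exists (fun=> 0); split; [exact: kk| |exact: xi_harm].
Qed.
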